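(* Let $4\le p\le n-1$, let $\langle R,S,T\rangle$ be a partition of $V$ with $0,n\in T$. The generalized max-cut inequality $$x((S:T))+\sum_{i\in R}x(\delta^+(i))\le \left\lfloor \tfrac{p+|R|}{2}\right\rfloor$$ is valid for $P^p_{0,n}(D)$, and it is facet defining for $P^p_{0,n}(D)$ if and only if $p+|R|$ is odd, $|S|>(p-|R|)/2$, $|T\setminus\{0\}|>(p-|R|)/2$, and either (i) $p=|R|+3$, $|R|\ge 2$ and $|T|=3$, or (ii) $p\ge |R|+5$.
   Context: Let $n$ be a positive integer, $V=\{0,1,\dots,n\}$, and let $D=(V,A)$ be the digraph whose arc set $A$ consists of all ordered pairs $(i,j)$ with $i\neq j$, $i,j\in V$, except that no arc enters node $0$, no arc leaves node $n$, and the arc $(0,n)$ is absent. A $(0,n)$-$p$-path is a simple directed path in $D$ from $0$ to $n$ with exactly $p$ arcs. $P^p_{0,n}(D)\subseteq\mathbb{R}^A$ is the convex hull of the incidence vectors of all $(0,n)$-$p$-paths. For $F\subseteq A$, $x(F)=\sum_{(i,j)\in F}x_{ij}$; $\delta^+(k)$ is the set of arcs of $A$ leaving node $k$. For node sets $S,T$, $(S:T)=\{(i,j)\in A: i\in S, j\in T\}$. Facet defining means valid and defining a face of dimension $\dim P^p_{0,n}(D)-1$. *)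

(* Defs.v *)
From HB Require Import structures.
From mathcomp Require Import all_boot all_order all_algebra.
From mathcomp Require Import reals.
Set Implicit Arguments. Unset Strict Implicit. Unset Printing Implicit Defensive.
Import Order.TTheory GRing.Theory Num.Theory.
Local Open Scope ring_scope.

Definition node (n : nat) := 'I_n.+1.

Definition is_arc (n : nat) (a : node n * node n) : bool :=
  [&& a.1 != a.2, a.2 != ord0, a.1 != ord_max
    & ~~ ((a.1 == ord0) && (a.2 == ord_max))].

Definition arc (n : nat) := {a : node n * node n | is_arc a}.

Definition is_p_path (n p : nat) (s : seq (node n)) : bool :=
  [&& size s == p.+1, head ord0 s == ord0, last ord0 s == ord_max,
      uniq s & sorted (fun i j => is_arc (i, j)) s].

Definition incid (R : realType) (n : nat) (s : seq (node n)) : arc n -> R :=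
  fun a => ((val a \in zip s (behead s)) : bool)%:R.

Definition path_polytope (R : realType) (n p : nat) (x : arc n -> R) : Prop :=
  exists (k : nat) (lam : 'I_k -> R) (ps : 'I_k -> seq (node n)),
    [/\ forall i, 0 <= lam i,
        \sum_(i < k) lam i = 1,
        forall i, is_p_path p (ps i)
      & forall a, x a = \sum_(i < k) lam i * incid R (ps i) a].

Definition aff_indep (R : realType) (n k : nat) (pts : 'I_k -> arc n -> R) : Prop :=
  forall lam : 'I_k -> R,
    \sum_(i < k) lam i = 0 ->
    (forall a, \sum_(i < k) lam i * pts i a = 0) ->
    forall i, lam i = 0.

(* dim X = d: maximal number of affinely independent points of X is d+1
   (so the empty set has dimension -1). *)
Definition has_dim (R : realType) (n : nat) (X : (arc n -> R) -> Prop) (d : int) : Prop :=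
  (exists (k : nat) (pts : 'I_k -> arc n -> R),
      k%:Z = d + 1 /\ (forall i, X (pts i)) /\ aff_indep pts) /\
  (forall (k : nat) (pts : 'I_k -> arc n -> R),
      (forall i, X (pts i)) -> aff_indep pts -> k%:Z <= d + 1).

Definition valid_ineq (R : realType) (n : nat) (P : (arc n -> R) -> Prop)
  (c : (arc n -> R) -> R) (b : R) : Prop :=
  forall x, P x -> c x <= b.

Definition facet_defining (R : realType) (n : nat) (P : (arc n -> R) -> Prop)
  (c : (arc n -> R) -> R) (b : R) : Prop :=
  valid_ineq P c b /\
  exists d : int, has_dim P d /\ has_dim (fun x => P x /\ c x = b) (d - 1).

Definition x_cut (R : realType) (n : nat) (S T : {set node n}) (x : arc n -> R) : R :=
  \sum_(a : arc n | ((val a).1 \in S) && ((val a).2 \in T)) x a.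

Definition x_out (R : realType) (n : nat) (i : node n) (x : arc n -> R) : R :=
  \sum_(a : arc n | (val a).1 == i) x a.

Definition gen_maxcut_lhs (R : realType) (n : nat) (Rs S T : {set node n})
  (x : arc n -> R) : R :=
  x_cut S T x + \sum_(i in Rs) x_out i x.

(* Main.v *)
(* Evaluating linear functionals on incidence vectors reduces facetness to a statement about
   functions [f] on the arcs and the sums [wt f s] of [f] along [p]-paths [s]: the face is a facet
   iff every [f] whose sum vanishes on all tight paths is, on all [p]-paths, a multiple of the
   slack of the inequality.

   Necessity. A path with [c] arcs in [(S:T)] and [a] nodes in [R] satisfies [2c + a <= p], since
   these arcs are disjoint and avoid node 0; tightness leaves a total slack of at most one in
   [2c + a <= p] and [a <= |R|]. When a condition fails, this forces two independent
   equations on the tight paths (an arc never used, a node always visited).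

   Sufficiency. Put [p - |R| = 2m + 1]. Replacing one node [v] of a tight path by an unused node
   [v'] yields [f(u,v) + f(v,w) = f(u,v') + f(v',w)] for many [u], [w]. Normalising [f] to vanish
   on the arcs out of a fixed node of [S], these relations determine [f] up to three constants, and
   give [f(i,j) = pi(i) - pi(j) + lam + mu * g(i,j)] with [g] the left-hand side coefficients. *)

Require Import Defs.
From HB Require Import structures.
From mathcomp Require Import all_boot all_order all_algebra.
From mathcomp Require Import reals.
From mathcomp Require Import zify ring lra.
Set Implicit Arguments. Unset Strict Implicit. Unset Printing Implicit Defensive.
Import Order.TTheory GRing.Theory Num.Theory.
(* [Defs.arc] is otherwise shadowed by [arc] of mathcomp's path.v. *)
Import Defs.
Local Open Scope ring_scope.

(** * Walks and their weights *)

(** With [p - #|Rs| = 2m + 1] the bound is [m + #|Rs|], and there are exactly two kinds of tight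
    paths: those with all of [Rs], [m] arcs from [S] to [T] and one node of [S] or [T] outside these
    arcs (node 0 not counted), and those missing one node of [Rs], with [m + 1] such arcs and no
    node of [S] or [T] to spare. An exchange of two nodes is usable only if both paths are of these
    kinds, which depends on the classes of the few nodes around the exchange; the rest of the path
    is a neutral filler. The obstacle is [m = 1]: an exchange whose surroundings need a second arc
    of the cut is then impossible. The same values are obtained by placing a node of [Rs] next to
    the exchanged node, and when another node of [Rs] is already involved this takes two of them;
    arcs between inner nodes of [T] cannot be reached in this way, and do not exist when [#|T| = 3].
    For necessity, two equations of the face are shown to be independent by evaluating both on two
    explicit paths and comparing the cross products. *)

Definition arcs (T : Type) (s : seq T) : seq (T * T) := zip s (behead s).

Definition wt (R : realType) (n : nat) (f : node n -> node n -> R) (s : seq (node n)) : R :=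
  \sum_(a <- arcs s) f a.1 a.2.

Lemma arcs_cat (T : Type) (A B : seq T) (u v : T) :
  arcs (rcons A u ++ v :: B) = arcs (rcons A u) ++ (u, v) :: arcs (v :: B).
Proof.
elim: A => [|x A IH] //=.
case: A IH => [|y A] IH //=; congr cons; exact: IH.
Qed.

Lemma unzip1_arcs (T : Type) (x : T) s : unzip1 (arcs (x :: s)) = belast x s.
Proof. by elim: s x => [|y s IH] x //=; congr cons; exact: IH. Qed.

Lemma unzip2_arcs (T : Type) (x : T) s : unzip2 (arcs (x :: s)) = s.
Proof. by elim: s x => [|y s IH] x //=; congr cons; exact: IH. Qed.

Lemma uniq_arcs (T : eqType) (s : seq T) : uniq s -> uniq (arcs s).
Proof.
case: s => // x s /= /andP[_ us]; apply: (@map_uniq _ _ snd).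
by rewrite -/(unzip2 _) unzip2_arcs.
Qed.

Lemma mem_arcs (T : eqType) (s : seq T) a : a \in arcs s -> a.1 \in s /\ a.2 \in s.
Proof.
case: s => // x s h; split.
  have := map_f fst h; rewrite -/(unzip1 _) unzip1_arcs => h1.
  exact: mem_belast.
have := map_f snd h; rewrite -/(unzip2 _) unzip2_arcs => h1.
by rewrite inE h1 orbT.
Qed.

Lemma sorted_arcs (T : eqType) (e : rel T) s :
  sorted e s = all (fun a => e a.1 a.2) (arcs s).
Proof.
case: s => // x s /=; elim: s x => [|y s IH] x //=; by rewrite IH.
Qed.

Section Walks.
Variables (R : realType) (n : nat).
Implicit Types (f h : node n -> node n -> R) (s A B : seq (node n)).

Lemma wt_split f A u v w B :
  wt f (rcons A u ++ v :: w :: B) = wt f (rcons A u) + (f u v + f v w) + wt f (w :: B).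
Proof.
by rewrite /wt arcs_cat big_cat /= /arcs /= !big_cons /= !addrA.
Qed.

Lemma wt_count (e : rel (node n)) s :
  wt (fun i j => (e i j)%:R : R) s = (count (fun a => e a.1 a.2) (arcs s))%:R.
Proof.
rewrite /wt; elim: (arcs s) => [|a l IH]; first by rewrite big_nil.
by rewrite big_cons IH /= natrD.
Qed.

Lemma wt_lin f h (a b : R) s :
  wt (fun i j => a * f i j + b * h i j) s = a * wt f s + b * wt h s.
Proof. by rewrite /wt big_split /= !mulr_sumr. Qed.

Lemma wt_const (a : R) s : wt (fun _ _ => a) s = (size s).-1%:R * a.
Proof.
rewrite /wt big_const_seq iter_addr_0 count_predT mulr_natl.
by congr (_ *+ _); rewrite /arcs size_zip size_behead; lia.
Qed.

Lemma wt_telescope (g : node n -> R) x s :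
  wt (fun i j => g i - g j) (x :: s) = g x - g (last x s).
Proof.
rewrite /wt; elim: s x => [|y s IH] x /=; first by rewrite /arcs big_nil subrr.
have -> : arcs [:: x, y & s] = (x, y) :: arcs (y :: s) by [].
by rewrite big_cons IH /= addrA subrK.
Qed.

Lemma eq_wt f h s : (forall i j, is_arc (i, j) -> f i j = h i j) ->
  sorted (fun i j => is_arc (i, j)) s -> wt f s = wt h s.
Proof.
move=> e; rewrite sorted_arcs /wt => /allP H.
rewrite !big_seq; apply: eq_bigr => a /H; by case: a => i j /= /e.
Qed.

End Walks.

(** Distinctness of the nodes already excludes loops, arcs into node 0 and arcs out of node [n]; the
    arc from 0 to [n] is excluded because [p] exceeds 1. *)
Lemma p_path_intro n p (l : seq (node n)) : (1 < p)%N -> size l = p -> uniq (ord0 :: l) ->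
  last ord0 l = ord_max -> is_p_path p (ord0 :: l).
Proof.
move=> p1 sl ul ll; rewrite /is_p_path /= sl eqxx ll eqxx /=; move: (ul) => /= ->.
set s := ord0 :: l.
have -> : path (fun i j => is_arc (i, j)) ord0 l = sorted (fun i j => is_arc (i, j)) s by [].
have us : uniq s by exact: ul.
have ss : size s = p.+1 by rewrite /= sl.
have n0 : nth ord0 s 0 = ord0 by [].
have nl : nth ord0 s p = ord_max by rewrite -ll (last_nth ord0) sl.
have E i j : (i <= p)%N -> (j <= p)%N -> (nth ord0 s i == nth ord0 s j) = (i == j).
  by move=> ip jp; rewrite nth_uniq ?ss.
apply/(sortedP ord0) => i; rewrite ss ltnS => ip.
rewrite /is_arc /=.
have -> : (nth ord0 l i == ord0) = false by rewrite (E i.+1 0%N).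
have -> : (nth ord0 s i == nth ord0 l i) = false.
  by rewrite (E i i.+1) //; lia.
have E0 : (nth ord0 s i == ord0) = (i == 0%N) by rewrite (E i 0%N) //; lia.
have -> : (nth ord0 s i == ord_max) = false by rewrite -nl E //; lia.
have -> : (nth ord0 l i == ord_max) = (i.+1 == p) by rewrite -nl (E i.+1 p).
by rewrite E0 /=; lia.
Qed.

Lemma p_path_elim n p (s : seq (node n)) : is_p_path p s ->
  exists l, [/\ s = ord0 :: l, size l = p, uniq (ord0 :: l),
             last ord0 l = ord_max & sorted (fun i j => is_arc (i, j)) s].
Proof.
case/and5P; case: s => // x l /eqP[sl] /eqP /= -> /eqP ll ul sr.
by exists l.
Qed.

(** * Faces and linear functionals *)

Definition ev (R : realType) n (f : node n -> node n -> R) (x : arc n -> R) : R :=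
  \sum_(a : arc n) f (val a).1 (val a).2 * x a.

Lemma ev_incid (R : realType) n p (f : node n -> node n -> R) s :
  is_p_path p s -> ev f (incid R s) = wt f s.
Proof.
case/and5P=> _ _ _ us; rewrite sorted_arcs => /allP ha.
rewrite /ev /incid -/(arcs s) /wt (big_uniq _ (uniq_arcs us)) /=.
pose G (b : node n * node n) := f b.1 b.2 * (b \in arcs s)%:R.
transitivity (\sum_(a : arc n) G (val a)); first by [].
rewrite -(big_sub (fun b => is_arc b) G) /=.
rewrite big_mkcond [RHS]big_mkcond /=; apply: eq_bigr => b _; rewrite /G.
have [bs|_] := boolP (b \in arcs s); last by rewrite mulr0 if_same.
have := ha _ bs; rewrite -surjective_pairing unfold_in => ->.
by rewrite mulr1.
Qed.

(** * Dimension as the rank of a matrix of points *)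

Section Dimension.
Variables (R : realType) (n : nat).
Implicit Types (x : arc n -> R) (f : node n -> node n -> R).

Definition vec x : 'rV[R]_#|{: arc n}| := \row_j x (enum_val j).

Definition functional f : 'cV[R]_#|{: arc n}| :=
  \col_j f (val (enum_val j : arc n)).1 (val (enum_val j : arc n)).2.

(** A column vector read back as a function on pairs of nodes. Off the arcs the value 0 is a mere
    default, since paths use only arcs. *)
Definition unfunctional (c : 'cV[R]_#|{: arc n}|) (i j : node n) : R :=
  if (insub (i, j) : option (arc n)) is Some a then c (enum_rank a) 0 else 0.

Lemma mul_vec_functional x f : vec x *m functional f = (ev f x)%:M.
Proof.
apply/matrixP => i j; rewrite !ord1 !mxE eqxx mulr1n /ev.
rewrite (reindex (@enum_val _ (mem {: arc n}))) /=; last first.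
  by apply: onW_bij; apply: enum_val_bij.
by apply: eq_bigr => k _; rewrite !mxE mulrC.
Qed.

Lemma unfunctionalK c : functional (unfunctional c) = c.
Proof.
apply/matrixP => i j; rewrite !ord1 !mxE /unfunctional -surjective_pairing.
by rewrite valK enum_valK.
Qed.

Lemma vec_lin k (lam : 'I_k -> R) (pts : 'I_k -> arc n -> R) x :
  (forall a, x a = \sum_i lam i * pts i a) -> vec x = \sum_i lam i *: vec (pts i).
Proof.
move=> e; apply/rowP => j; rewrite !mxE summxE e.
by apply: eq_bigr => i _; rewrite !mxE.
Qed.

Definition vecs k (pts : 'I_k -> arc n -> R) := \matrix_i vec (pts i).

Lemma mul_vecs k (u : 'rV[R]_k) (pts : 'I_k -> arc n -> R) :
  u *m vecs pts = \sum_i u 0 i *: vec (pts i).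
Proof. by rewrite mulmx_sum_row; apply: eq_bigr => i _; rewrite rowK. Qed.

(* On the hyperplane [x (\delta^+ 0) = 1], affine and linear independence agree. *)
Definition source_arc (i _ : node n) : R := (i == ord0)%:R.

Lemma aff_indep_row_free k (pts : 'I_k -> arc n -> R) :
  (forall i, ev source_arc (pts i) = 1) -> aff_indep pts <-> row_free (vecs pts).
Proof.
move=> h1; split=> [ai|rf lam _ e i].
  apply: inj_row_free => u; rewrite mul_vecs => u0.
  have ev0 : forall a, \sum_i u 0 i * pts i a = 0.
    move=> a; have := congr1 (fun w : 'rV_ _ => w 0 (enum_rank a)) u0.
    rewrite summxE mxE; apply: etrans; apply: eq_bigr => i _.
    by rewrite !mxE enum_rankK.
  apply/rowP => i; rewrite mxE; apply: (ai (fun i => u 0 i)) => //.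
  (* Each point has value 1 under this functional, so a linear dependency has coefficients of sum 0
     and is an affine one. *)
  have := congr1 (mulmx^~ (functional source_arc)) u0.
  rewrite mul0mx mulmx_suml => /(congr1 (fun w : 'M_1 => w 0 0)).
  rewrite summxE mxE; apply: etrans; apply: eq_bigr => k0 _.
  by rewrite -scalemxAl mul_vec_functional h1 !mxE mulr1.
have : (\row_i lam i) *m vecs pts == 0.
  rewrite mul_vecs; apply/eqP/rowP => j; rewrite summxE mxE -[RHS](e (enum_val j)).
  by apply: eq_bigr => k0 _; rewrite !mxE.
rewrite mulmx_free_eq0 // => /eqP/rowP/(_ i); by rewrite !mxE.
Qed.

Lemma has_dim_rank (X : (arc n -> R) -> Prop) N (pts : 'I_N -> arc n -> R) :
  (forall i, X (pts i)) -> (forall x, X x -> (vec x <= vecs pts)%MS) ->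
  (forall x, X x -> ev source_arc x = 1) ->
  has_dim X ((\rank (vecs pts))%:Z - 1).
Proof.
move=> hp hs h1; split.
  exists (\rank (vecs pts)), (fun i => pts (maxrankfun (vecs pts) i)).
  split; [by rewrite subrK|split=> //].
  apply/aff_indep_row_free => [i|]; first exact: h1.
  have -> : vecs (fun i => pts (maxrankfun (vecs pts) i)) =
            rowsub (maxrankfun (vecs pts)) (vecs pts).
    by apply/matrixP => i j; rewrite !mxE.
  exact: maxrowsub_free.
move=> k q hq /aff_indep_row_free => /(_ (fun i => h1 _ (hq i))) rf.
rewrite subrK lez_nat -(eqP rf); apply: mxrankS.
by apply/row_subP => i; rewrite rowK; apply: hs.
Qed.

Lemma has_dim_uniq (X : (arc n -> R) -> Prop) d e :
  has_dim X d -> has_dim X e -> d = e.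
Proof.
move=> [[k [q [ke [hq aq]]]] ub] [[k' [q' [ke' [hq' aq']]]] ub'].
have := ub _ _ hq' aq'; have := ub' _ _ hq aq.
by lia.
Qed.

End Dimension.

(** * Facets in terms of weights of paths *)

Section Facet.
Variables (R : realType) (n p : nat) (g : node n -> node n -> R) (b : R).
Variable c : (arc n -> R) -> R.
Hypothesis cE : forall x, c x = ev g x.
Hypothesis wt_le : forall s, is_p_path p s -> wt g s <= b.
Implicit Types (f h : node n -> node n -> R) (s A B : seq (node n)).

Lemma ev_comb f k (lam : 'I_k -> R) (ps : 'I_k -> seq (node n)) x :
  (forall i, is_p_path p (ps i)) ->
  (forall a, x a = \sum_(i < k) lam i * incid R (ps i) a) ->
  ev f x = \sum_i lam i * wt f (ps i).
Proof.
move=> hp e; rewrite /ev.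
under eq_bigr => a _ do rewrite e mulr_sumr.
rewrite exchange_big /=; apply: eq_bigr => i _; rewrite -(ev_incid f (hp i)) mulr_sumr.
by apply: eq_bigr => a _; rewrite mulrCA.
Qed.

Lemma valid_of_paths : valid_ineq (@path_polytope R n p) c b.
Proof.
move=> x [k [lam [ps [l0 l1 hp e]]]]; rewrite cE (ev_comb g hp e).
rewrite -[b]mul1r -l1 mulr_suml; apply: ler_sum => i _.
by apply: ler_wpM2l => //; apply: wt_le.
Qed.

Definition p_paths : seq (seq (node n)) :=
  [seq tval t | t <- enum {: p.+1.-tuple (node n)} & is_p_path p (tval t)].

Lemma mem_p_paths s : (s \in p_paths) = is_p_path p s.
Proof.
apply/mapP/idP => [[t]|hs]; first by rewrite mem_filter => /andP[ht _] ->.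
have sz : size s == p.+1 by case/and5P: hs.
by exists (Tuple sz) => //; rewrite mem_filter mem_enum hs.
Qed.

Definition tight_paths := [seq s <- p_paths | wt g s == b].

Definition nth_incid (l : seq (seq (node n))) (i : 'I_(size l)) : arc n -> R :=
  incid R (nth [::] l i).

Lemma incid_sub (l : seq (seq (node n))) s : s \in l ->
  (vec (incid R s) <= vecs (@nth_incid l))%MS.
Proof.
move=> sl; have il : (index s l < size l)%N by rewrite index_mem.
have <- : row (Ordinal il) (vecs (@nth_incid l)) = vec (incid R s).
  by rewrite rowK /nth_incid /= nth_index.
exact: row_sub.
Qed.

Lemma incid_in s : is_p_path p s -> path_polytope p (incid R s).
Proof.
move=> hs; exists 1%N, (fun _ => 1), (fun _ => s); split=> //.
  by rewrite big_ord1.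
by move=> a; rewrite big_ord1 mul1r.
Qed.

Lemma wt_source_arc s : (0 < p)%N -> is_p_path p s -> wt (@source_arc R n) s = 1.
Proof.
move=> p0 /p_path_elim [l [-> sl /= /andP[l0 _] ll _]].
case: l sl l0 ll => [|y l] sl l0 ll; first by move: p0; rewrite -sl.
rewrite /wt (_ : arcs _ = (ord0, y) :: arcs (y :: l)) // big_cons {1}/source_arc eqxx.
rewrite big1_seq ?addr0 // => a /= /mem_arcs[h _]; rewrite /source_arc.
by case: eqP h l0 => // -> ->.
Qed.

Lemma source_arc_polytope x : (0 < p)%N -> path_polytope p x -> ev (@source_arc R n) x = 1.
Proof.
move=> p0 [k [lam [ps [l0 l1 hp e]]]]; rewrite (ev_comb _ hp e) -[RHS]l1.
by apply: eq_bigr => i _; rewrite wt_source_arc ?mulr1.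
Qed.

Lemma polytope_sub x : path_polytope p x -> (vec x <= vecs (@nth_incid p_paths))%MS.
Proof.
move=> [k [lam [ps [l0 l1 hp e]]]]; rewrite (vec_lin e).
apply: summx_sub => i _; apply: scalemx_sub; apply: incid_sub.
by rewrite mem_p_paths.
Qed.

(** The slack of a convex combination is the combination of the nonnegative slacks of its paths; if
    it is zero, only tight paths have a nonzero coefficient. *)
Lemma face_sub x : path_polytope p x -> c x = b ->
  (vec x <= vecs (@nth_incid tight_paths))%MS.
Proof.
move=> [k [lam [ps [l0 l1 hp e]]]]; rewrite cE (ev_comb g hp e) => cb.
have z0 : \sum_i lam i * (b - wt g (ps i)) = 0.
  under eq_bigr do rewrite mulrBr.
  by rewrite sumrB cb -mulr_suml l1 mul1r subrr.
rewrite (vec_lin e); apply: summx_sub => i _.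
have /eqP : lam i * (b - wt g (ps i)) = 0.
  have := psumr_eq0P _ z0; apply=> // j _; apply: mulr_ge0 => //.
  by rewrite subr_ge0 wt_le.
rewrite mulf_eq0 => /orP[/eqP ->|]; first by rewrite scale0r sub0mx.
rewrite subr_eq0 eq_sym => t; apply: scalemx_sub; apply: incid_sub.
by rewrite mem_filter t mem_p_paths hp.
Qed.

Hypothesis p_gt0 : (0 < p)%N.

Let MP := vecs (@nth_incid p_paths).
Let MF := vecs (@nth_incid tight_paths).

Lemma dim_polytope : has_dim (@path_polytope R n p) ((\rank MP)%:Z - 1).
Proof.
apply: has_dim_rank => [i|x|x].
- by apply: incid_in; rewrite -mem_p_paths mem_nth.
- exact: polytope_sub.
- exact: source_arc_polytope.
Qed.

Lemma tight_path_nth i : i \in tight_paths -> is_p_path p i /\ wt g i = b.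
Proof. by rewrite mem_filter mem_p_paths => /andP[/eqP ? ?]. Qed.

Lemma dim_face :
  has_dim (fun x => path_polytope p x /\ c x = b) ((\rank MF)%:Z - 1).
Proof.
apply: has_dim_rank => [i|x|x].
- have [h1 h2] := tight_path_nth (mem_nth [::] (ltn_ord i)).
  by split; [exact: incid_in | rewrite cE (ev_incid _ h1)].
- by move=> [hx cx]; apply: face_sub.
- by move=> [hx _]; apply: source_arc_polytope.
Qed.

Lemma facet_rank : facet_defining (@path_polytope R n p) c b <->
  \rank MP = (\rank MF).+1.
Proof.
split=> [[_ [d [hd hf]]]|e].
  by have := has_dim_uniq hd dim_polytope; have := has_dim_uniq hf dim_face; lia.
split; first exact: valid_of_paths.
exists ((\rank MP)%:Z - 1); split; first exact: dim_polytope.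
by have := dim_face; rewrite e; congr has_dim; lia.
Qed.

Lemma wt_functional f s : is_p_path p s ->
  vec (incid R s) *m functional f = (wt f s)%:M.
Proof. by move=> hs; rewrite mul_vec_functional (ev_incid _ hs). Qed.

Lemma MF_annihilates f : (forall s, is_p_path p s -> wt g s = b -> wt f s = 0) ->
  MF *m functional f = 0.
Proof.
move=> h; apply/row_matrixP => i; rewrite row_mul rowK row0.
have [h1 h2] := tight_path_nth (mem_nth [::] (ltn_ord i)).
by rewrite wt_functional // h // raddf0.
Qed.

Lemma functional_sub k (u : 'rV_#|{: arc n}|) (M : 'M[R]_(k, _)) f :
  (u <= M)%MS -> M *m functional f = 0 -> u *m functional f = 0.
Proof. by case/submxP=> D ->; rewrite -mulmxA => ->; rewrite mulmx0. Qed.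

(** For a facet, the span of all paths exceeds the span of the tight ones by one dimension. Two
    functionals vanishing on tight paths therefore factor through a line and are proportional, which
    the cross products express without division. *)
Lemma facet_nec f h A B :
  facet_defining (@path_polytope R n p) c b ->
  (forall s, is_p_path p s -> wt g s = b -> wt f s = 0 /\ wt h s = 0) ->
  is_p_path p A -> is_p_path p B ->
  wt f A * wt h B = wt f B * wt h A.
Proof.
move=> /facet_rank rk fh hA hB.
have F0 : MF *m functional f = 0 by apply: MF_annihilates => s h1 h2; case: (fh s h1 h2).
have H0 : MF *m functional h = 0 by apply: MF_annihilates => s h1 h2; case: (fh s h1 h2).
have sc (x : R) : x%:M = 0 :> 'M_1 -> x = 0.
  by move/matrixP/(_ 0 0); rewrite !mxE eqxx mulr1n.
have [AF|AF] := boolP (vec (incid R A) <= MF)%MS.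
  have := functional_sub AF F0; rewrite wt_functional // => /sc ->.
  have := functional_sub AF H0; rewrite wt_functional // => /sc ->.
  by rewrite mul0r mulr0.
have [BF|BF] := boolP (vec (incid R B) <= MF + vec (incid R A))%MS; last first.
  have l1 : (MF < MF + vec (incid R A))%MS.
    by rewrite ltmxE addsmxSl /=; apply: contra AF; apply: submx_trans; apply: addsmxSr.
  have l2 : (MF + vec (incid R A) < MF + vec (incid R A) + vec (incid R B))%MS.
    by rewrite ltmxE addsmxSl /=; apply: contra BF; apply: submx_trans; apply: addsmxSr.
  have l3 : (MF + vec (incid R A) + vec (incid R B) <= MP)%MS.
    rewrite !addsmx_sub !incid_sub ?mem_p_paths // !andbT.
    apply/row_subP => i; rewrite rowK; apply: incid_sub.
    have [h1 _] := tight_path_nth (mem_nth [::] (ltn_ord i)).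
    by rewrite mem_p_paths.
  have := mxrankS l3; have := rank_ltmx l1; have := rank_ltmx l2.
  by rewrite rk; lia.
case/sub_addsmxP: BF => [[u v]] /= e.
have E k : MF *m functional k = 0 -> wt k B = v 0 0 * wt k A.
  move=> k0; have := congr1 (mulmx^~ (functional k)) e.
  rewrite wt_functional // mulmxDl -!mulmxA k0 mulmx0 add0r wt_functional //.
  by move/matrixP/(_ 0 0); rewrite !mxE big_ord1 !mxE eqxx !mulr1n.
by rewrite (E f) // (E h) //; ring.
Qed.

(** The nontight path [A] makes the rank of the tight paths drop by at least one. It drops by no
    more, because a functional that vanishes on the tight paths and on [A] is a multiple of the
    slack with factor 0, hence vanishes on every path. *)
Lemma facet_suff A :
  (forall f, (forall s, is_p_path p s -> wt g s = b -> wt f s = 0) ->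
     exists mu, forall s, is_p_path p s -> wt f s = mu * (wt g s - b)) ->
  is_p_path p A -> wt g A != b ->
  facet_defining (@path_polytope R n p) c b.
Proof.
move=> H hA nA; apply/facet_rank.
have FP : (MF <= MP)%MS.
  apply/row_subP => i; rewrite rowK; apply: incid_sub.
  have [h1 _] := tight_path_nth (mem_nth [::] (ltn_ord i)).
  by rewrite mem_p_paths.
have AF : ~~ (vec (incid R A) <= MF)%MS.
  apply: contraNN nA => AF.
  (* The slack, up to sign, as a linear functional: the constant [b] is carried by the single arc
     leaving node 0. *)
  pose h i j := g i j - b * source_arc R i j.
  have hE s : is_p_path p s -> wt h s = wt g s - b.
    move=> hs; have := wt_lin g (@source_arc R n) 1 (-b) s.
    rewrite wt_source_arc // mul1r mulr1 => <-; apply: eq_wt => [i j _|].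
      by rewrite /h; ring.
    by case/and5P: hs.
  have H0 : MF *m functional h = 0.
    by apply: MF_annihilates => s h1 h2; rewrite hE // h2 subrr.
  have := functional_sub AF H0; rewrite wt_functional // hE //.
  by move/matrixP/(_ 0 0); rewrite !mxE eqxx mulr1n => /eqP; rewrite subr_eq0.
have lt : (\rank MF < \rank MP)%N.
  apply: rank_ltmx; rewrite ltmxE FP /=; apply: contra AF; apply: submx_trans.
  by apply: incid_sub; rewrite mem_p_paths.
apply/eqP; rewrite eqn_leq lt andbT.
have le1 : (\rank (MF + vec (incid R A)) <= (\rank MF).+1)%N.
  have := rank_leq_row (vec (incid R A)).
  have [] := mxrank_adds_leqif MF (vec (incid R A)); lia.
apply: leq_trans le1; apply: mxrankS.
set U := (MF + _)%MS.
apply/row_subP => i; rewrite rowK.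
set s := nth [::] p_paths i.
have hs : is_p_path p s by rewrite -mem_p_paths mem_nth.
rewrite submxE; apply/eqP/matrixP => k j; rewrite [RHS]mxE ord1 {k}.
(* Membership in the row space of [U] is tested column by column on its cokernel; each column is a
   functional to which the hypothesis [H] applies. *)
pose cc := col j (cokermx U).
have Uc : U *m cc = 0 by rewrite /cc colE mulmxA mulmx_coker mul0mx.
have e : functional (unfunctional cc) = cc by apply: unfunctionalK.
have Fc : MF *m cc = 0.
  have /submxP[D ->] : (MF <= U)%MS by apply: addsmxSl.
  by rewrite -mulmxA Uc mulmx0.
have Ac : vec (incid R A) *m cc = 0.
  have /submxP[D ->] : (vec (incid R A) <= U)%MS by apply: addsmxSr.
  by rewrite -mulmxA Uc mulmx0.
have wE q : is_p_path p q -> (vec (incid R q) *m cc) 0 0 = wt (unfunctional cc) q.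
  by move=> hq; rewrite -{1}e wt_functional // mxE eqxx mulr1n.
have [|mu hmu] := H (unfunctional cc).
  move=> q hq tq; rewrite -wE //.
  have /submxP[D ->] : (vec (incid R q) <= MF)%MS.
    by apply: incid_sub; rewrite mem_filter tq eqxx mem_p_paths.
  by rewrite -mulmxA Fc mulmx0 mxE.
have := wE A hA; rewrite Ac hmu // mxE => /eqP.
rewrite eq_sym mulf_eq0 subr_eq0 (negbTE nA) orbF => /eqP mu0.
have := wE s hs; rewrite hmu // mu0 mul0r => <-.
by rewrite !mxE; apply: eq_bigr => k _; rewrite !mxE.
Qed.

End Facet.

(** * Validity *)

Section CountSet.
Variable T : finType.
Implicit Types (A : {set T}) (l : seq T).

Lemma count_setE A l : uniq l -> count [in A] l = #|[set x in l] :&: A|.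
Proof.
move=> ul; rewrite -size_filter -(card_uniqP (filter_uniq _ ul)).
by apply: eq_card => x; rewrite mem_filter !inE andbC.
Qed.

Lemma count_set_le A l : uniq l -> (count [in A] l <= #|A|)%N.
Proof. by move=> ul; rewrite count_setE // subset_leq_card // subsetIr. Qed.

Lemma count_set_full A l x : uniq l -> count [in A] l = #|A| -> x \in A -> x \in l.
Proof.
move=> ul; rewrite count_setE // => e; have /eqP <- : ([set x in l] :&: A) == A.
  by rewrite eqEcard subsetIr e leqnn.
by rewrite !inE => /andP[].
Qed.

Lemma count_set_ge A l u : uniq u -> {subset u <= l} -> {subset u <= A} ->
  (size u <= count [in A] l)%N.
Proof.
move=> uu ul uA; rewrite -size_filter; apply: uniq_leq_size => // x xu.
by rewrite mem_filter ul // andbT; apply: uA.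
Qed.

Lemma fresh_elt A l : (size l < #|A|)%N -> exists2 x, x \in A & x \notin l.
Proof.
move=> h; have [/subsetP H|/subsetPn [x xA xl]] := boolP (A \subset l); last by exists x.
suff : (#|A| <= size l)%N by lia.
by apply: leq_trans (card_size l); apply/subset_leq_card/subsetP.
Qed.

End CountSet.

Lemma count_belast (T : Type) (P : pred T) x l :
  (count P (belast x l) + P (last x l) = P x + count P l)%N.
Proof. by elim: l x => [|y l IH] x /=; rewrite ?addn0 // -addnA IH. Qed.

Definition maxcut_weight (R : realType) n (Rs S T : {set node n}) (i j : node n) : R :=
  ((i \in S) && (j \in T))%:R + (i \in Rs)%:R.

Lemma gen_maxcut_lhsE (R : realType) n (Rs S T : {set node n}) (x : arc n -> R) :
  gen_maxcut_lhs Rs S T x = ev (maxcut_weight R Rs S T) x.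
Proof.
rewrite /gen_maxcut_lhs /x_cut /x_out /ev /maxcut_weight.
under [RHS]eq_bigr => a _ do rewrite mulrDl.
rewrite big_split /=; congr (_ + _).
  rewrite big_mkcond; apply: eq_bigr => a _.
  by case: ifP => _; rewrite ?mul1r ?mul0r.
rewrite (exchange_big_dep xpredT) //=; apply: eq_bigr => a _.
rewrite -big_filter; have [h|h] := boolP (_ \in Rs).
  rewrite mul1r big_filter (eq_bigl (pred1 (val a).1)) ?big_pred1_eq // => i /=.
  by rewrite eq_sym; case: eqP => [->|]; rewrite ?h ?andbF.
rewrite mul0r big_filter big_pred0 // => i.
by rewrite eq_sym; case: eqP => [->|]; rewrite ?(negbTE h) ?andbF.
Qed.

Section PathCounts.
Variables (R : realType) (n p : nat).
Implicit Types (s l : seq (node n)).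

Lemma p_path_uniq s : is_p_path p s -> uniq s.
Proof. by case/and5P. Qed.

Lemma count_tails s (A : {set node n}) : is_p_path p s -> ord0 \notin A -> ord_max \notin A ->
  count (fun a => a.1 \in A) (arcs s) = count [in A] s.
Proof.
case/p_path_elim => l [-> _ _ ll _] A0 An.
rewrite (_ : count _ _ = count [in A] (unzip1 (arcs (ord0 :: l)))); last by rewrite count_map.
rewrite unzip1_arcs; have := count_belast [in A] ord0 l.
by rewrite ll (negbTE A0) (negbTE An) /= (negbTE A0); lia.
Qed.

Lemma count_heads s (A : {set node n}) :
  count (fun a => a.2 \in A) (arcs s) = count [in A] (behead s).
Proof.
case: s => // x l.
rewrite (_ : count _ _ = count [in A] (unzip2 (arcs (x :: l)))); last by rewrite count_map.
by rewrite unzip2_arcs.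
Qed.

Lemma count_lt (U : eqType) (P Q : pred U) (l : seq U) a : subpred P Q ->
  a \in l -> ~~ P a -> Q a -> (count P l < count Q l)%N.
Proof.
move=> PQ; elim: l => //= x l IH; rewrite inE => /orP[/eqP <-|al] nP Qa.
  by rewrite (negbTE nP) Qa /= add0n add1n ltnS sub_count.
have := IH al nP Qa; have := PQ x; case: (P x) => [/(_ isT) ->|_]; lia.
Qed.

(** The equation saying that [v] is visited is affine; subtracting the arc out of node 0, used
    exactly once, makes it linear. *)
Lemma wt_visits s v : (0 < p)%N -> is_p_path p s -> v != ord0 -> v != ord_max ->
  wt (fun i _ => (i == v)%:R - (i == ord0)%:R : R) s = (v \in s)%:R - 1.
Proof.
move=> p0 hs v0 vn.
have us := p_path_uniq hs.
transitivity (wt (fun i j => 1 * (i == v)%:R + (-1) * source_arc R i j) s).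
  apply: eq_wt; last by case/and5P: hs.
  by move=> i j _; rewrite /source_arc; ring.
rewrite (wt_lin (fun i _ => (i == v)%:R)) (wt_source_arc R p0 hs) mulr1 mul1r; congr (_ + _).
rewrite (wt_count R (fun i _ => i == v)).
have := @count_tails s [set v] hs; rewrite !inE ![_ == v]eq_sym => /(_ v0 vn).
rewrite (eq_count (a2 := pred1 v)); last by move=> x; rewrite /= inE.
rewrite count_uniq_mem // => <-; congr _%:R.
by apply: eq_count => a /=; rewrite inE.
Qed.

Lemma wt_arc s i j : is_p_path p s ->
  wt (fun x y => ((x == i) && (y == j))%:R : R) s = ((i, j) \in arcs s)%:R.
Proof.
move=> hs; rewrite (wt_count R (fun x y => (x == i) && (y == j))).
rewrite -(count_uniq_mem _ (uniq_arcs (p_path_uniq hs))); congr _%:R.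
Qed.

End PathCounts.

(** * Counting nodes and cut arcs along a path *)

Section Tight.
Variables (R : realType) (n p : nat) (Rs S T : {set node n}).
Hypothesis part : forall x, ((x \in Rs) + (x \in S) + (x \in T) = 1)%N.
Hypothesis T0 : ord0 \in T.
Hypothesis Tn : ord_max \in T.
Implicit Types (s l : seq (node n)).

Local Notation g := (maxcut_weight R Rs S T).

Definition ncut s := count (fun a => (a.1 \in S) && (a.2 \in T)) (arcs s).

Lemma ends_notin : [/\ ord0 \notin Rs, ord0 \notin S, ord_max \notin Rs & ord_max \notin S].
Proof. by have := part ord0; have := part ord_max; rewrite T0 Tn; do 4!case: (_ \in _). Qed.

Lemma wt_maxcut s : is_p_path p s -> wt g s = (ncut s + count [in Rs] s)%:R.
Proof.
move=> hs; have [r0 _ rn _] := ends_notin.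
rewrite natrD -(count_tails hs r0 rn) /ncut /wt /maxcut_weight big_split /=; congr (_ + _).
  exact: (wt_count R (fun i j => (i \in S) && (j \in T))).
exact: (wt_count R (fun i j => i \in Rs)).
Qed.

Lemma path_size s : is_p_path p s ->
  (count [in Rs] s + count [in S] s + count [in T] (behead s))%N = p.
Proof.
case/p_path_elim => l [-> sl _ _ _]; have [r0 s0 _ _] := ends_notin.
rewrite /= (negbTE r0) (negbTE s0) /= !add0n -sl.
elim: l {sl} => //= x l IH; have := part x; lia.
Qed.

Lemma ncut_le_S s : is_p_path p s -> (ncut s <= count [in S] s)%N.
Proof.
move=> hs; have [_ s0 _ sn] := ends_notin.
by rewrite -(count_tails hs s0 sn); apply: sub_count => a /andP[].
Qed.

Lemma ncut_le_T s : (ncut s <= count [in T] (behead s))%N.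
Proof. by rewrite -count_heads; apply: sub_count => a /andP[]. Qed.

(** A node of [S] left by an arc outside the cut is lost for the cut. Together with its counterpart
    for [T], this measures how an arc uses up the slack that a tight path may have. *)
Lemma ncut_lt_S s i j : is_p_path p s -> (i, j) \in arcs s -> i \in S -> j \notin T ->
  (ncut s < count [in S] s)%N.
Proof.
move=> hs ij iS jT; have [_ s0 _ sn] := ends_notin.
rewrite -(count_tails hs s0 sn); apply: (count_lt (a := (i, j))) => //=.
  by move=> a /andP[].
by rewrite (negbTE jT) andbF.
Qed.

Lemma ncut_lt_T s i j : (i, j) \in arcs s -> i \notin S -> j \in T ->
  (ncut s < count [in T] (behead s))%N.
Proof.
move=> ij iS jT; rewrite -count_heads; apply: (count_lt (a := (i, j))) => //=.
  by move=> a /andP[].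
by rewrite (negbTE iS).
Qed.

Lemma count_T_le s : is_p_path p s -> (count [in T] (behead s) <= #|T :\ ord0|)%N.
Proof.
case/p_path_elim => l [-> _ /= /andP[l0 ul] _ _].
apply: leq_trans (count_set_le _ ul); rewrite leq_eqVlt; apply/orP; left; apply/eqP.
apply: eq_in_count => x xl /=; rewrite !inE; case: eqP => // e.
by rewrite e (negbTE l0) in xl.
Qed.

Lemma maxcut_bound s : is_p_path p s -> wt g s <= ((p + #|Rs|)./2)%:R.
Proof.
move=> hs; rewrite wt_maxcut // ler_nat.
have := path_size hs; have := ncut_le_S hs; have := ncut_le_T s.
have := count_set_le Rs (p_path_uniq hs); lia.
Qed.

End Tight.

(** * Necessity of the conditions *)

Lemma filler (T : finType) (l : seq T) k : uniq l -> (size l + k <= #|T|)%N ->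
  exists m, [/\ size m = k, uniq m & {in m, forall x, x \notin l}].
Proof.
move=> ul h; pose m := enum (~: [set x in l]).
have sm : size m = (#|T| - size l)%N.
  by rewrite -cardE cardsCs setCK cardsE (card_uniqP ul).
exists (take k m); split.
- by rewrite size_take sm; case: ltnP; lia.
- exact/take_uniq/enum_uniq.
- by move=> x /mem_take; rewrite mem_enum !inE.
Qed.

(** The bound [p <= n - 1] leaves at least one node off every [p]-path, so the nodes completing [l]
    can be chosen to avoid [e]. The same completion serves with [l] at the end or at the
    beginning. *)
Lemma extend_path n p (l : seq (node n)) e : (4 <= p)%N -> (p <= n - 1)%N ->
  uniq [:: ord0, ord_max, e & l] -> (size l <= p.-1)%N ->
  exists m, [/\ is_p_path p (ord0 :: m ++ rcons l ord_max),
                is_p_path p (ord0 :: l ++ rcons m ord_max) & e \notin m].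
Proof.
move=> p4 pn ul sl.
have h : ((size l).+3 + (p.-1 - size l) <= n.+1)%N by lia.
have [|m [sm um hm]] := @filler _ [:: ord0, ord_max, e & l] (p.-1 - size l) ul.
  by rewrite card_ord.
have em : e \notin m by apply/negP => /hm; rewrite !inE eqxx !orbT.
have m0 : ord0 \notin m by apply/negP => /hm; rewrite !inE eqxx.
have mn : ord_max \notin m by apply/negP => /hm; rewrite !inE eqxx !orbT.
have ml : ~~ has [in m] l.
  by apply/hasPn => x xl; apply/negP => /hm; rewrite !inE xl !orbT.
move: ul; rewrite /= !inE !negb_or => /and4P[/and3P[n0 _ l0] /andP[_ ln] _ ul].
have lm : ~~ has [in l] m by rewrite has_sym.
exists m; split=> //; apply: p_path_intro; try lia.
- by rewrite size_cat size_rcons sm; lia.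
- rewrite /= mem_cat negb_or m0 /= mem_rcons inE negb_or n0 l0 /= cat_uniq um.
  by rewrite rcons_uniq ln ul /= -cats1 has_cat /= negb_or ml orbF mn.
- by rewrite last_cat last_rcons.
- by rewrite size_cat size_rcons sm; lia.
- rewrite /= mem_cat negb_or l0 /= mem_rcons inE negb_or n0 m0 /= cat_uniq ul.
  by rewrite rcons_uniq mn um /= -cats1 has_cat /= negb_or lm orbF ln.
- by rewrite last_cat last_rcons.
Qed.

Lemma arcs_infix (T : eqType) (A B : seq T) u v : (u, v) \in arcs (A ++ u :: v :: B).
Proof. by rewrite -cat_rcons arcs_cat mem_cat inE eqxx orbT. Qed.

Lemma uniq_map_inj (T U : eqType) (f : T -> U) (l : seq T) x y :
  uniq (map f l) -> x \in l -> y \in l -> f x = f y -> x = y.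
Proof.
elim: l => //= z l IH /andP[zl ul].
rewrite !inE => /orP[/eqP ->|xl] /orP[/eqP ->|yl] e //; last exact: IH.
  by rewrite e map_f in zl.
by rewrite -e map_f in zl.
Qed.

Lemma arcs_head_uniq (T : eqType) (s : seq T) u v w : uniq s ->
  (u, v) \in arcs s -> (u, w) \in arcs s -> v = w.
Proof.
case: s => // x s us h1 h2.
suff: (u, v) = (u, w) by case.
apply: (@uniq_map_inj _ _ fst (arcs (x :: s))) => //.
rewrite -/(unzip1 _) unzip1_arcs; move: us; rewrite lastI rcons_uniq.
by case/andP.
Qed.

Lemma arcs_asym (T : eqType) (s : seq T) u v : uniq s ->
  (u, v) \in arcs s -> (v, u) \in arcs s -> False.
Proof.
elim: s => // x [|y s] IH // us; rewrite (_ : arcs _ = (x, y) :: arcs (y :: s)) // !inE.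
have xs : x \notin y :: s by case/andP: us.
rewrite !xpair_eqE => /orP[/andP[/eqP -> /eqP ->]|h1] /orP[/andP[/eqP e1 /eqP e2]|h2].
- by rewrite e2 inE eqxx in xs.
- by have [_ /= h] := mem_arcs h2; rewrite h in xs.
- by rewrite e1 in h1; have [_ /= h] := mem_arcs h1; rewrite h in xs.
- by apply: IH => //; case/andP: us.
Qed.

(* [lia] without the boolean hypotheses on nodes, whose case analysis is prohibitively slow. *)
Ltac nlia := repeat match goal with
  | H : is_true (_ \in _) |- _ => clear H
  | H : is_true (~~ _) |- _ => clear H
  | H : is_true (is_p_path _ _) |- _ => clear H
  | H : is_true (uniq _) |- _ => clear H
  end; lia.

Section Necessity.
Variables (R : realType) (n p : nat) (Rs S T : {set node n}).
Hypothesis part : forall x, ((x \in Rs) + (x \in S) + (x \in T) = 1)%N.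
Hypothesis T0 : ord0 \in T.
Hypothesis Tn : ord_max \in T.
Hypothesis p4 : (4 <= p)%N.
Hypothesis pn : (p <= n - 1)%N.
Implicit Types (s : seq (node n)) (i j k v w e x y : node n) (f h : node n -> node n -> R).

Local Notation g := (maxcut_weight R Rs S T).
Local Notation facet := (facet_defining (@path_polytope R n p) (gen_maxcut_lhs Rs S T)
     ((p + #|Rs|)./2)%:R).

Definition tight s := is_p_path p s && (ncut S T s + count [in Rs] s == (p + #|Rs|)./2)%N.

Lemma tightE s : is_p_path p s -> (wt g s == ((p + #|Rs|)./2)%:R) = tight s.
Proof. by move=> hs; rewrite /tight hs (wt_maxcut R part T0 Tn hs) eqr_nat. Qed.

Let p0 : (0 < p)%N. Proof. lia. Qed.

Let p2 : (2 <= p.-1)%N. Proof. lia. Qed.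

Lemma ord0_neq_max : (ord0 : node n) != ord_max.
Proof. by rewrite -val_eqE /=; lia. Qed.

Lemma facet_cross f h A B :
  facet -> (forall s, tight s -> wt f s = 0 /\ wt h s = 0) ->
  is_p_path p A -> is_p_path p B -> wt f A * wt h B = wt f B * wt h A.
Proof.
move=> F H; apply: (facet_nec (g := g) _ _ p0 F) => [x|s hs|s hs /eqP].
- exact: gen_maxcut_lhsE.
- exact: (maxcut_bound R part T0 Tn hs).
- by rewrite tightE //; apply: H.
Qed.

Let visit v (i _ : node n) : R := (i == v)%:R - (i == ord0)%:R.
Let use_arc i j (x y : node n) : R := ((x == i) && (y == j))%:R.

Let wt_use_arc s i j : is_p_path p s -> wt (use_arc i j) s = ((i, j) \in arcs s)%:R.
Proof. exact: wt_arc. Qed.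

Let wt_visit s v : is_p_path p s -> v != ord0 -> v != ord_max ->
  wt (visit v) s = (v \in s)%:R - 1.
Proof. by move=> hs v0 vn; rewrite -(wt_visits R p0 hs v0 vn). Qed.

Lemma tight_p_path s : tight s -> is_p_path p s.
Proof. by case/andP. Qed.

(** * Pairs of equations that exclude a facet *)

Lemma nonfacet_two_arcs k (l : node n) (A B : seq (node n)) i j :
  (forall s, tight s -> (k, l) \notin arcs s /\ (i, j) \notin arcs s) ->
  is_p_path p A -> is_p_path p B -> (k, l) \in arcs A -> (i, j) \notin arcs A ->
  (i, j) \in arcs B -> ~ facet.
Proof.
move=> H hA hB A1 A2 B1 F.
have := @facet_cross (use_arc k l) (use_arc i j) A B F _ hA hB.
rewrite !wt_use_arc // A1 (negbTE A2) B1 !mulr0 mulr1 => E.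
have /eqP : 1 = 0 :> R; last by rewrite oner_eq0.
apply: E => s ts; have [h1 h2] := H s ts.
by rewrite !wt_use_arc ?tight_p_path // (negbTE h1) (negbTE h2).
Qed.

(** A path never contains an arc and its reverse, so two paths, one through each arc, separate the
    two equations. *)
Lemma nonfacet_asym k (l : node n) : uniq [:: ord0; ord_max; k; l] ->
  (forall s, tight s -> (k, l) \notin arcs s /\ (l, k) \notin arcs s) -> ~ facet.
Proof.
move=> u H.
have [e] : exists e, e \notin [:: ord0; ord_max; k; l].
  have [|e _ he] := @fresh_elt _ [set: node n] [:: ord0; ord_max; k; l]; last by exists e.
  by rewrite cardsT card_ord /=; lia.
rewrite !inE !negb_or => /and4P[e0 en ek el].
move: u; rewrite /= !inE !negb_or => /and4P[/and3P[a1 a2 a3] /andP[a4 a5] a6 _].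
have [||m [h1 _ _]] := @extend_path n p [:: k; l] e p4 pn.
- by rewrite /= !inE !negb_or a1 a2 a3 a4 a5 a6 ek el ![_ == e]eq_sym e0 en.
- exact: p2.
have [||m' [h1' _ _]] := @extend_path n p [:: l; k] e p4 pn.
- by rewrite /= !inE !negb_or a1 a2 a3 a4 a5 ek el [l == k]eq_sym a6 ![_ == e]eq_sym e0 en.
- exact: p2.
have hA : (k, l) \in arcs (ord0 :: m ++ rcons [:: k; l] ord_max).
  exact: (arcs_infix (ord0 :: m)).
apply: (nonfacet_two_arcs H h1 h1') => //; last exact: (arcs_infix (ord0 :: m')).
by apply/negP => hB; apply: (arcs_asym (p_path_uniq h1) hA hB).
Qed.

(** A path leaves [k] at most once, so the two arcs never occur together. *)
Lemma nonfacet_fork k i j : uniq [:: ord0; ord_max; k; i; j] ->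
  (forall s, tight s -> (k, i) \notin arcs s /\ (k, j) \notin arcs s) -> ~ facet.
Proof.
move=> u H.
move: u; rewrite /= !inE !negb_or => /and5P[/and4P[a1 a2 a3 b1] /and3P[a4 a5 b2] /andP[a6 b3] b4 _].
have [||m [h1 _ _]] := @extend_path n p [:: k; i] j p4 pn.
- by rewrite /= !inE !negb_or a1 a2 a3 a4 a5 a6 b1 b2 ![j == _]eq_sym b3 b4.
- exact: p2.
have [||m' [h1' _ _]] := @extend_path n p [:: k; j] i p4 pn.
- by rewrite /= !inE !negb_or a1 a2 a3 a4 a5 b1 b2 b3 b4 [i == k]eq_sym a6.
- exact: p2.
have hA : (k, i) \in arcs (ord0 :: m ++ rcons [:: k; i] ord_max).
  exact: (arcs_infix (ord0 :: m)).
apply: (nonfacet_two_arcs H h1 h1') => //; last exact: (arcs_infix (ord0 :: m')).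
apply: contraNN b4 => hB; apply/eqP.
exact: (arcs_head_uniq (p_path_uniq h1) hA hB).
Qed.

Lemma path_avoiding v : v != ord0 -> v != ord_max ->
  exists2 s, is_p_path p s & v \notin s.
Proof.
move=> v0 vn; have [||m [h1 _ hm]] := @extend_path n p [::] v p4 pn => //.
  by rewrite /= !inE !negb_or ord0_neq_max ![_ == v]eq_sym v0 vn.
exists (ord0 :: m ++ rcons [::] ord_max) => //.
by rewrite inE mem_cat mem_seq1 !negb_or v0 hm.
Qed.

Lemma path_through v e : uniq [:: ord0; ord_max; v; e] ->
  exists s s', [/\ is_p_path p s, is_p_path p s', (v, ord_max) \in arcs s,
     (ord0, v) \in arcs s' & e \notin s].
Proof.
move=> u; have u' : uniq [:: ord0; ord_max; e; v].
  by rewrite -(@perm_uniq _ [:: ord0; ord_max; v; e]) // !perm_cons (perm_catC [:: v] [:: e]).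
have [||m [h1 h2 hm]] := @extend_path n p [:: v] e p4 pn => //=; first by lia.
exists (ord0 :: m ++ rcons [:: v] ord_max), (ord0 :: [:: v] ++ rcons m ord_max); split=> //.
- exact: (arcs_infix (ord0 :: m)).
- by rewrite /arcs /= inE eqxx.
- move: u; rewrite /= !inE !negb_or => /and4P[/and3P[a1 a2 a3] /andP[a4 a5] a6 _].
  by rewrite mem_cat !inE !negb_or hm ![e == _]eq_sym a3 a5 a6.
Qed.

Lemma path_through1 v : v != ord0 -> v != ord_max ->
  exists s s', [/\ is_p_path p s, is_p_path p s', (v, ord_max) \in arcs s &
     (ord0, v) \in arcs s'].
Proof.
move=> v0 vn; have [|e _] := @fresh_elt _ [set: node n] [:: ord0; ord_max; v].
  by rewrite cardsT card_ord /=; lia.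
rewrite !inE !negb_or => /and3P[e0 en ev].
have [|s [s' [h1 h2 h3 h4 _]]] := @path_through v e; last by exists s, s'.
by rewrite /= !inE !negb_or ord0_neq_max ![_ == e]eq_sym e0 en ev ![_ == v]eq_sym v0 vn.
Qed.

(** On a path avoiding [v] the arc is absent as well, because [v] is one of its ends: there the
    visit equation fails and the arc equation holds, whereas on [A] it is the other way round. *)
Lemma nonfacet_visit_arc v i j A : v != ord0 -> v != ord_max ->
  (forall s, tight s -> v \in s /\ (i, j) \notin arcs s) ->
  is_p_path p A -> (i, j) \in arcs A -> v \in A -> v \in [:: i; j] -> ~ facet.
Proof.
move=> v0 vn H hA ijA vA vij F; have [B hB vB] := path_avoiding v0 vn.
have ijB : (i, j) \notin arcs B.
  apply: contraNN vB => /mem_arcs /= [iB jB].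
  by move: vij; rewrite !inE => /orP[] /eqP ->.
have := @facet_cross (visit v) (use_arc i j) A B F _ hA hB.
rewrite !wt_use_arc // !wt_visit // ijA (negbTE ijB) (negbTE vB) vA subrr mul0r mulr1 sub0r.
move=> E; have /eqP : 0 = -1 :> R.
  apply: E => s ts; have [h1 h2] := H s ts.
  rewrite wt_use_arc ?tight_p_path // wt_visit ?tight_p_path // h1 (negbTE h2) subrr.
  by split.
by rewrite eq_sym oppr_eq0 oner_eq0.
Qed.

Lemma nonfacet_last v : v != ord0 -> v != ord_max ->
  (forall s, tight s -> v \in s /\ (v, ord_max) \notin arcs s) -> ~ facet.
Proof.
move=> v0 vn H; have [s [s' [h1 h2 h3 h4]]] := path_through1 v0 vn.
apply: (nonfacet_visit_arc v0 vn H h1 h3); last by rewrite inE eqxx.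
by case: (mem_arcs h3).
Qed.

Lemma nonfacet_first v : v != ord0 -> v != ord_max ->
  (forall s, tight s -> v \in s /\ (ord0, v) \notin arcs s) -> ~ facet.
Proof.
move=> v0 vn H; have [s [s' [h1 h2 h3 h4]]] := path_through1 v0 vn.
apply: (nonfacet_visit_arc v0 vn H h2 h4); last by rewrite !inE eqxx orbT.
by case: (mem_arcs h4).
Qed.

Lemma nonfacet_visit2 v w : uniq [:: ord0; ord_max; v; w] ->
  (forall s, tight s -> v \in s /\ w \in s) -> ~ facet.
Proof.
move=> u H F.
have [s [_ [hs _ sv _ ws]]] := path_through u.
have vs : v \in s by case: (mem_arcs sv).
move: u; rewrite /= !inE !negb_or => /and4P[/and3P[a1 a2 a3] /andP[a4 a5] a6 _].
rewrite eq_sym in a2; rewrite eq_sym in a3; rewrite eq_sym in a4; rewrite eq_sym in a5.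
have [s' hs' vs'] := path_avoiding a2 a4.
have := @facet_cross (visit v) (visit w) s s' F _ hs hs'.
rewrite !wt_visit // (negbTE vs') (negbTE ws) vs subrr mul0r sub0r mulN1r opprK.
move=> E; have /eqP : 0 = 1 :> R.
  apply: E => q tq; have [h1 h2] := H q tq.
  by rewrite !wt_visit ?tight_p_path // h1 h2 subrr.
by rewrite eq_sym oner_eq0.
Qed.

Lemma card_partition : (#|Rs| + #|S| + #|T| = n.+1)%N.
Proof.
have cE (A : {set node n}) : #|A| = (\sum_x (x \in A))%N.
  by rewrite -sum1_card big_mkcond; apply: eq_bigr => x _; case: (x \in A).
rewrite !cE -!big_split /= (eq_bigr (fun=> 1%N)) => [|x _]; last exact: part.
by rewrite sum1_card card_ord.
Qed.

Lemma cardT0 : #|T| = #|T :\ ord0|.+1.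
Proof. by rewrite (cardsD1 (ord0 : node n)) T0. Qed.

Lemma card_T_inner : #|T :\ ord0| = #|T :\ ord0 :\ ord_max|.+1.
Proof. by rewrite (cardsD1 ord_max (T :\ ord0)) !inE Tn eq_sym ord0_neq_max. Qed.

Lemma notin_T_neq x : x \notin T -> [/\ x \notin T, x != ord0 & x != ord_max].
Proof. by move=> xT; split=> //; apply: contraNneq xT => ->. Qed.

Lemma R_inner x : x \in Rs -> [/\ x \notin T, x != ord0 & x != ord_max].
Proof.
by move=> xR; apply: notin_T_neq; have := part x; rewrite xR; case: (x \in T) => //; lia.
Qed.

Lemma S_inner x : x \in S -> [/\ x \notin T, x != ord0 & x != ord_max].
Proof.
by move=> xS; apply: notin_T_neq; have := part x; rewrite xS; case: (x \in T) => //; lia.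
Qed.

Lemma inner_uniq x y : x != y -> x != ord0 -> x != ord_max -> y != ord0 -> y != ord_max ->
  uniq [:: ord0; ord_max; x; y].
Proof.
by move=> xy x0 xn y0 yn; rewrite /= !inE !negb_or ord0_neq_max xy ![_ == x]eq_sym
  ![_ == y]eq_sym x0 y0 xn yn.
Qed.

Lemma tight_counts s : tight s ->
  [/\ (ncut S T s + count [in Rs] s = (p + #|Rs|)./2)%N,
      (count [in Rs] s + count [in S] s + count [in T] (behead s) = p)%N,
      (ncut S T s <= count [in S] s)%N /\ (ncut S T s <= count [in T] (behead s))%N,
      (count [in Rs] s <= #|Rs|)%N
    & (count [in S] s <= #|S|)%N /\ (count [in T] (behead s) <= #|T :\ ord0|)%N].
Proof.
case/andP=> hs /eqP e; have us := p_path_uniq hs; split=> //.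
- exact: path_size hs.
- by split; [exact: ncut_le_S hs | exact: ncut_le_T].
- exact: count_set_le.
- by split; [exact: count_set_le | exact: count_T_le hs].
Qed.

Lemma tight_visits (A : {set node n}) s v : tight s -> count [in A] s = #|A| -> v \in A -> v \in s.
Proof. by move=> /tight_p_path /p_path_uniq us; apply: count_set_full. Qed.

Lemma tight_visits_T s v : tight s -> count [in T] (behead s) = #|T :\ ord0| ->
  v \in T -> v != ord0 -> v \in s.
Proof.
move=> /tight_p_path /p_path_elim [l [-> _ /= /andP[l0 ul] _ _]] e vT v0.
rewrite inE; apply/orP; right; apply: (@count_set_full _ (T :\ ord0)) => //.
  2: by rewrite !inE v0.
rewrite -e; apply: eq_in_count => x xl; rewrite !inE.
by case: eqP => // x0; rewrite -x0 xl in l0.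
Qed.

Lemma tight_arc_S s i j : tight s -> (i, j) \in arcs s -> i \in S -> j \notin T ->
  (ncut S T s < count [in S] s)%N.
Proof. by move=> /tight_p_path hs; apply: (ncut_lt_S part T0 Tn hs). Qed.

Lemma tight_arc_T s i j : (i, j) \in arcs s -> i \notin S -> j \in T ->
  (ncut S T s < count [in T] (behead s))%N.
Proof. exact: ncut_lt_T. Qed.

Lemma T_notin_S x : x \in T -> x \notin S.
Proof. by have := part x; lia. Qed.

Lemma S_notin_T x : x \in S -> x \notin T.
Proof. by have := part x; lia. Qed.

Lemma R_notin_S x : x \in Rs -> x \notin S.
Proof. by have := part x; lia. Qed.

(** * Failure of each condition *)

(** In the even case a tight path has no slack at all: it visits all of [Rs], leaves each of its
    nodes in [S] through the cut and enters each of its nodes in [T] other than node 0 through the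
    cut. Hence no arc runs inside [S], between inner nodes of [T], or from [Rs] to [n]. *)
Lemma nonfacet_even : ~~ odd (p + #|Rs|) -> ~ facet.
Proof.
move=> /negbTE ev.
have E s : tight s -> count [in Rs] s = #|Rs| /\ ncut S T s = count [in S] s /\
    ncut S T s = count [in T] (behead s).
  by case/tight_counts=> h1 h2 [h3 h4] h5 [h6 h7]; nlia.
have [r0|] := posnP #|Rs|; last first.
  case/card_gt0P=> v vR; have [vT v0 vn] := R_inner vR.
  apply: (@nonfacet_last v) => // s ts; have [e1 [e2 e3]] := E s ts.
  split; first exact: tight_visits e1 vR.
  apply/negP => h; have := tight_arc_T h (R_notin_S vR) Tn; nlia.
have [S2|S1] := ltnP 1 #|S|.
  have /card_gt1P[k [l [kS lS kl]]] := S2.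
  have [kT k0 kn] := S_inner kS.
  have [lT l0 ln] := S_inner lS.
  apply: (@nonfacet_asym k l); first exact: inner_uniq.
  move=> s ts; have [e1 [e2 e3]] := E s ts.
  split; apply/negP => h.
    by have := tight_arc_S ts h kS lT; nlia.
  by have := tight_arc_S ts h lS kT; nlia.
(* There are at least six nodes, none in [Rs] and at most one in [S]. *)
have : (1 < #|T :\ ord0 :\ ord_max|)%N.
  by have := card_T_inner; have := card_partition; have := cardT0; nlia.
case/card_gt1P=> k [l [+ + kl]]; rewrite !inE => /and3P[kn k0 kT] /and3P[ln l0 lT].
apply: (@nonfacet_asym k l); first exact: inner_uniq.
move=> s ts; have [e1 [e2 e3]] := E s ts.
split; apply/negP => h.
  by have := tight_arc_T h (T_notin_S kT) lT; nlia.
by have := tight_arc_T h (T_notin_S lT) kT; nlia.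
Qed.

(** The inequality is strict because [ord_max] is a further node of [T] on the path. *)
Lemma count_T_gt s (u : seq (node n)) : is_p_path p s -> uniq u ->
  {subset u <= s} -> {subset u <= T :\ ord0 :\ ord_max} ->
  (size u < count [in T] (behead s))%N.
Proof.
case/p_path_elim => l [-> sl _ ll _] uu us uT.
apply: (@count_set_ge _ T l (ord_max :: u)) => [|x|x].
- by rewrite /= uu andbT; apply/negP => /uT; rewrite !inE eqxx.
- rewrite inE => /orP[/eqP ->|xu].
    by rewrite -ll; case: l sl {ll us} => [|y l] sl;
      [by move: p4; rewrite -sl | exact: (mem_last y)].
  by have := us x xu; have := uT x xu; rewrite !inE => /and3P[_ /negbTE ->].
- by rewrite inE => /orP[/eqP -> //|/uT]; rewrite !inE => /and3P[].
Qed.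

Lemma nonfacet_large_R : odd (p + #|Rs|) -> (p <= #|Rs|.+1)%N -> ~ facet.
Proof.
move=> od pR.
have /card_gt1P[i [j [iR jR ij]]] : (1 < #|Rs|)%N by nlia.
have [iT i0 in_] := R_inner iR.
have [jT j0 jn] := R_inner jR.
have [p1|p1] := eqVneq p #|Rs|.+1; last first.
  apply: (@nonfacet_asym i j); first exact: inner_uniq.
  (* By parity [p < #|Rs|], so the bound is at least [p], while a path reaches at most [p - 1]
     because its last node lies in [T]. No path is tight, and any pair of opposite arcs will do. *)
  move=> s ts; exfalso; have : (0 < count [in T] (behead s))%N.
    by apply: (@count_T_gt _ [::] (tight_p_path ts)).
  by move/eqP: p1; case/tight_counts: ts => h1 h2 [h3 h4] h5 [h6 h7]; nlia.
have [k kR] : exists k, k \notin [:: ord0; ord_max] ++ enum Rs.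
  have [|k _ hk] := @fresh_elt _ [set: node n] ([:: ord0; ord_max] ++ enum Rs); last by exists k.
  have h : (2 + #|Rs| < n.+1)%N by nlia.
  by rewrite cardsT card_ord size_cat -cardE.
move: kR; rewrite mem_cat mem_enum !inE !negb_or => /andP[/andP[k0 kn] kR].
apply: (@nonfacet_fork k i j).
  rewrite /= !inE !negb_or ord0_neq_max ij ![_ == k]eq_sym ![_ == i]eq_sym ![_ == j]eq_sym.
  rewrite k0 kn i0 j0 in_ jn /=.
  by apply/andP; split=> //; apply/andP; split; apply: contraNneq kR => <-.
move=> s ts.
(* With [p = #|Rs| + 1] a tight path meets [T] only in its two ends and leaves each of its nodes in
   [S] through the cut. So [k] has no arc into [Rs] if it lies in [S], and is not visited if it lies
   in [T]. *)
have ncount u := @count_T_gt s u (tight_p_path ts).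
have nT : (0 < count [in T] (behead s))%N by apply: (ncount [::]).
have [kS|kS] := boolP (k \in S).
  case/tight_counts: (ts) => h1 h2 [h3 h4] h5 [h6 h7].
  split; apply/negP => h.
    by have := tight_arc_S ts h kS iT; nlia.
  by have := tight_arc_S ts h kS jT; nlia.
have kT : k \in T by have := part k; rewrite (negbTE kR) (negbTE kS); case: (k \in T).
have ks : k \notin s.
  apply/negP => ks; have : (1 < count [in T] (behead s))%N.
    by apply: (ncount [:: k]) => // x; rewrite !inE => /eqP -> //; rewrite k0 kn.
  by case/tight_counts: (ts) => h1 h2 [h3 h4] h5 [h6 h7]; nlia.
by split; apply: contraNN ks => /mem_arcs[].
Qed.

(** If [S] has at most [(p - #|Rs|)/2] nodes, the bound is reached only by using all of [S] and all
    of [Rs]. Should these have fewer than two nodes together, the bound, which is at least 2, is out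
    of reach and no path is tight. *)
Lemma nonfacet_small_S : odd (p + #|Rs|) -> (2 * #|S| + #|Rs| <= p)%N -> ~ facet.
Proof.
move=> od sm.
have E s : tight s -> count [in Rs] s = #|Rs| /\ count [in S] s = #|S| /\ (2 <= #|S| + #|Rs|)%N.
  by case/tight_counts=> h1 h2 [h3 h4] h5 [h6 h7]; nlia.
have RS0 : [disjoint Rs & S].
  by apply/pred0P => x /=; have := part x; nlia.
have cU : #|Rs :|: S| = (#|Rs| + #|S|)%N by rewrite cardsU disjoint_setI0 // cards0 subn0.
have [/card_gt1P[v [w [vU wU vw]]]|few] := ltnP 1 #|Rs :|: S|.
  move: vU wU; rewrite !inE => vU wU.
  have inU x : (x \in Rs) || (x \in S) -> (x != ord0) /\ (x != ord_max).
    by case/orP=> [/R_inner|/S_inner] [].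
  have [v0 vn] := inU _ vU; have [w0 wn] := inU _ wU.
  apply: (@nonfacet_visit2 v w); first exact: inner_uniq.
  move=> s ts; have [e1 [e2 _]] := E s ts.
  by split; [case/orP: vU | case/orP: wU]; apply: tight_visits.
have : (1 < #|T :\ ord0 :\ ord_max|)%N.
  by have := card_T_inner; have := card_partition; have := cardT0; nlia.
case/card_gt1P=> k [l [+ + kl]]; rewrite !inE => /and3P[kn k0 kT] /and3P[ln l0 lT].
apply: (@nonfacet_visit2 k l); first exact: inner_uniq.
by move=> s ts; have [e1 [e2 e3]] := E s ts; nlia.
Qed.

(** A tight path must now visit all of [Rs] and all of [T], entering each node of [T] other than 0
    from [S]. A node of [Rs] is thus always visited but never last before [n]; if [Rs] is empty, an
    inner node of [T] is always visited but never directly after 0. *)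
Lemma nonfacet_small_T : odd (p + #|Rs|) -> (#|Rs|.+1 < p)%N ->
  (2 * #|T :\ ord0| + #|Rs| <= p)%N -> ~ facet.
Proof.
move=> od pR sm.
have E s : tight s -> count [in Rs] s = #|Rs| /\ ncut S T s = count [in T] (behead s) /\
    count [in T] (behead s) = #|T :\ ord0| /\ (p = 2 * #|T :\ ord0| + #|Rs| + 1)%N.
  by case/tight_counts=> h1 h2 [h3 h4] h5 [h6 h7]; nlia.
have [r0|] := posnP #|Rs|; last first.
  case/card_gt0P=> v vR; have [vT v0 vn] := R_inner vR.
  apply: (@nonfacet_last v) => // s ts; have [e1 [e2 [e3 e4]]] := E s ts.
  split; first exact: tight_visits e1 vR.
  by apply/negP => h; have := tight_arc_T h (R_notin_S vR) Tn; nlia.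
(* Without inner nodes in [T], a tight path would have [p = 3]; the second alternative covers this
   vacuous case with an arbitrary [v]. *)
have [v v0n] : exists v, (v != ord0) && (v != ord_max) && ((v \in T) || (#|T :\ ord0| < 2)%N).
  have := card_T_inner.
  have [t0|] := posnP #|T :\ ord0 :\ ord_max|.
    have [|v _] := @fresh_elt _ [set: node n] [:: ord0; ord_max].
      by rewrite cardsT card_ord /=; nlia.
    rewrite !inE negb_or => v0n e; exists v; rewrite v0n /= orbC; apply/orP; left; by rewrite e t0.
  by case/card_gt0P=> v; rewrite !inE => /and3P[vn v0 vT] _; exists v; rewrite vn v0 vT.
case/andP: v0n => /andP[v0 vn] vT.
apply: (@nonfacet_first v) => // s ts; have [e1 [e2 [e3 e4]]] := E s ts.
have {}vT : v \in T by case/orP: vT => //; clear -e4 p4 r0; lia.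
split; first exact: tight_visits_T e3 vT v0.
by apply/negP => h; have := tight_arc_T h (T_notin_S T0) vT; nlia.
Qed.

(** Two inner nodes of [T] on a path, together with [n], leave at most [#|Rs|] nodes for [Rs] and
    [S], too few for the bound [#|Rs| + 1]. So no tight path contains both nodes, and neither of the
    two arcs between them. *)
Lemma nonfacet_large_T : p = (#|Rs| + 3)%N -> (3 < #|T|)%N -> ~ facet.
Proof.
move=> pE T3.
have : (1 < #|T :\ ord0 :\ ord_max|)%N.
  by have := card_T_inner; have := cardT0; nlia.
case/card_gt1P=> k [l [+ + kl]]; rewrite !inE => /and3P[kn k0 kT] /and3P[ln l0 lT].
apply: (@nonfacet_asym k l); first exact: inner_uniq.
move=> s ts.
have H : k \in s -> l \in s -> False.
  move=> ks ls; have : (2 < count [in T] (behead s))%N.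
    apply: (@count_T_gt s [:: k; l] (tight_p_path ts)); first by rewrite /= inE kl.
      by move=> x; rewrite !inE => /orP[] /eqP ->.
    by move=> x; rewrite !inE => /orP[] /eqP ->; rewrite ?k0 ?kn ?l0 ?ln.
  by case/tight_counts: (ts) => h1 h2 [h3 h4] h5 [h6 h7]; nlia.
by split; apply/negP => /mem_arcs[/= h1 h2]; apply: H.
Qed.

(* Here the face satisfies [x(k,i) = x(i,n) + x(0,k)]. *)
Lemma nonfacet_four_arcs i k : p = 4%N -> Rs = [set i] -> T = [set ord0; ord_max; k] ->
  k != ord0 -> k != ord_max -> (1 < #|S|)%N -> ~ facet.
Proof.
move=> pE RE TE k0 kn /card_gt1P[u [w [uS wS uw]]] F.
have iR : i \in Rs by rewrite RE inE.
have kT : k \in T by rewrite TE !inE eqxx orbT.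
have inR x : (x \in Rs) = (x == i) by rewrite RE inE.
have inT x : x != ord0 -> x != ord_max -> (x \in T) = (x == k).
  by move=> x0 xn; rewrite TE !inE (negbTE x0) (negbTE xn).
have [iT i0 in_] := R_inner iR.
have ki : k != i by apply: contraNneq iT => <-.
have S_facts x : x \in S ->
    [/\ x != ord0, x != ord_max, (x == i) = false, (x == k) = false & (x \in T) = false].
  move=> xS; have [xT x0 xn] := S_inner xS.
  split=> //; last exact: negbTE.
    by apply/negbTE; apply: contraTneq xS => ->; apply: (R_notin_S iR).
  by rewrite -inT // (negbTE xT).
have [u0 un ui uk uT] := S_facts _ uS; have [w0 wn wi wk wT] := S_facts _ wS.
have kS := negbTE (T_notin_S kT); have iS := negbTE (R_notin_S iR).
have zn : ord0 != ord_max :> node n := ord0_neq_max.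
pose cnt i j s := ((i, j) \in arcs s)%:R : R.
pose f x y : R := 1 * ((x == k) && (y == i))%:R +
  (-1) * (1 * ((x == i) && (y == ord_max))%:R + 1 * ((x == ord0) && (y == k))%:R).
have fE s : is_p_path p s -> wt f s = cnt k i s - (cnt i ord_max s + cnt ord0 k s).
  by move=> hs; rewrite /f wt_lin wt_lin !(wt_arc R _ _ hs) !mul1r mulN1r.
pose h x y : R := 1 * g x y + (-2) * source_arc R x y.
have hE s : is_p_path p s -> wt h s = (ncut S T s + count [in Rs] s)%:R - 2.
  move=> hs; rewrite /h wt_lin (wt_source_arc R _ hs) ?(wt_maxcut R part T0 Tn hs);
    last by rewrite pE.
  by rewrite mul1r mulr1.
(* Both paths have slack 1, but [f] is -1 on [A] and -2 on [C], so [f] is not a multiple of the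
   slack. *)
pose A := [:: ord0; k; u; w; ord_max]; pose C := [:: ord0; k; u; i; ord_max].
have eqs := ((negbTE k0), (negbTE kn), (negbTE u0), (negbTE un), (negbTE w0), (negbTE wn),
   (negbTE i0), (negbTE in_), (negbTE zn), (negbTE uw), (negbTE ki), ui, uk, wi, wk).
have hA : is_p_path p A.
  apply: p_path_intro; rewrite ?pE //=.
  by rewrite !inE ![ord0 == _]eq_sym [k == u]eq_sym [k == w]eq_sym [ord_max == _]eq_sym !eqs.
have hC : is_p_path p C.
  apply: p_path_intro; rewrite ?pE //=.
  by rewrite !inE ![ord0 == _]eq_sym [k == u]eq_sym [ord_max == _]eq_sym !eqs.
have S0 : (ord0 \in S) = false := negbTE (T_notin_S T0).
have := @facet_cross f h A C F _ hA hC.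
rewrite !fE // !hE // /cnt /ncut /arcs /= !inE !xpair_eqE !eqxx ![ord0 == _]eq_sym
  ![ord_max == _]eq_sym ![i == _]eq_sym ![k == u]eq_sym ![k == w]eq_sym !eqs uS wS kS iS S0 uT wT
  kT Tn (negbTE iT) !inR !eqxx ![ord0 == _]eq_sym ![ord_max == _]eq_sym !eqs /=.
move=> E; suff /eqP : (2 : R) = 1 by rewrite -subr_eq0 (_ : 2 - 1 = 1) ?oner_eq0 //; ring.
suff H : forall s, tight s -> wt f s = 0 /\ wt h s = 0 by have := E H; lra.
move=> {E} s ts; have hs := tight_p_path ts.
case/andP: (ts) => _; rewrite pE RE cards1 /= => /eqP e2.
split; last by rewrite hE // RE e2 subrr.
rewrite fE // /cnt; move: e2; rewrite -RE.
case/p_path_elim: hs => l [-> + + + _]; rewrite pE.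
case: l => [|a [|b [|c [|d [|? ?]]]]] //= _ ul dE; move: ul; rewrite dE => ul.
(* Every inner node other than [k] and [i] lies in [S]. The equation on a tight path thus depends
   only on which of its three inner nodes equal [k] or [i], a finite check. *)
have inS x : x != ord0 -> x != ord_max -> (x \in S) = (x != k) && (x != i).
  move=> x0 xn; have := part x; rewrite inR inT //.
  by case: (x \in S); case: (x == k); case: (x == i).
have excl x y z : x != y -> (x == z) && (y == z) = false.
  by move=> xy; apply/negbTE; apply: contraNN xy => /andP[/eqP -> /eqP ->].

move: ul; rewrite !inE !negb_or => /and5P[/and4P[a0 b0 c0 _] /and3P[ab ac an] /andP[bc bn] cn _].
rewrite ![ord0 == _]eq_sym in a0 b0 c0.
rewrite /ncut /arcs /= ?inE ?xpair_eqE !S0 !inR !(inS _ a0 an) !(inS _ b0 bn) !(inS _ c0 cn)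
  !(inT _ b0 bn) !(inT _ c0 cn) Tn !eqxx ![ord0 == _]eq_sym ![ord_max == _]eq_sym.
rewrite !eqs ?(negbTE a0) ?(negbTE b0) ?(negbTE c0) ?(negbTE an) ?(negbTE bn) ?(negbTE cn) /=.
move: (excl _ _ k ab) (excl _ _ k ac) (excl _ _ k bc)
  (excl _ _ i ab) (excl _ _ i ac) (excl _ _ i bc).
rewrite ![k == a]eq_sym ![k == b]eq_sym ![k == c]eq_sym
  ![i == a]eq_sym ![i == b]eq_sym ![i == c]eq_sym.
have kiE x : (x == k) && (x == i) = false.
  by apply/negbTE; apply: contraNN ki => /andP[/eqP <- /eqP <-].
move: (kiE a) (kiE b) (kiE c).
case: (a == k); case: (a == i) => //; case: (b == k); case: (b == i) => //;
  case: (c == k); case: (c == i) => //= _ _ _ _ _ _ _ _ _ _; ring.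
Qed.

Lemma facet_conditions : facet ->
  [/\ odd (p + #|Rs|), (p < 2 * #|S| + #|Rs|)%N, (p < 2 * #|T :\ ord0| + #|Rs|)%N
    & ((p == #|Rs| + 3)%N && (2 <= #|Rs|)%N && (#|T| == 3)%N) || (#|Rs| + 5 <= p)%N].
Proof.
move=> F.
have [od|ev] := boolP (odd (p + #|Rs|)); last by case: (nonfacet_even ev F).
have [pR|pR] := leqP p #|Rs|.+1; first by case: (nonfacet_large_R od pR F).
have [sS|sS] := leqP (2 * #|S| + #|Rs|) p; first by case: (nonfacet_small_S od sS F).
have [sT|sT] := leqP (2 * #|T :\ ord0| + #|Rs|) p.
  by case: (nonfacet_small_T od pR sT F).
split=> //; have [p5|p5] := leqP (#|Rs| + 5) p; first by rewrite orbT.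
have pE : p = (#|Rs| + 3)%N by lia.
have [T3|T3] := ltnP 3 #|T|; first by case: (nonfacet_large_T pE T3 F).
have TE := cardT0; have TI := card_T_inner.
have T3' : #|T| = 3%N by lia.
rewrite -pE eqxx T3' /= orbF andbT; apply: contraT; rewrite -leqNgt => R1.
have R1' : #|Rs| = 1%N.
  have r1 : (0 < #|Rs|)%N by clear -pE p4; lia.
  by apply/eqP; rewrite eqn_leq r1 andbT.
have /eqP/cards1P[i iE] := R1'.
have /eqP/cards1P[k kE] : #|T :\ ord0 :\ ord_max| = 1%N by lia.
have : k \in T :\ ord0 :\ ord_max by rewrite kE inE.
rewrite !inE => /and3P[kn k0 kT].
have p4' : p = 4%N by lia.
exfalso; apply: (nonfacet_four_arcs (i := i) (k := k)) => //; last by lia.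
apply/setP => x; have := congr1 (fun A : {set node n} => x \in A) kE.
rewrite !inE; have [->|_] := eqVneq x ord0; first by rewrite T0.
by have [->|_] := eqVneq x ord_max; rewrite ?Tn.
Qed.

End Necessity.

(** * Sufficiency of the conditions *)

Lemma free_elts (T : finType) (A : {set T}) (l : seq T) k : uniq l ->
  (count [in A] l + k <= #|A|)%N ->
  exists q, [/\ size q = k, uniq q, {subset q <= A} & {in q, forall x, x \notin l}].
Proof.
move=> ul h; pose q := enum (A :\: [set x in l]).
have sq : size q = (#|A| - count [in A] l)%N.
  rewrite -cardE count_setE // setIC; have := cardsID [set x in l] A; lia.
exists (take k q); split.
- by rewrite size_take sq; case: ltnP; lia.
- exact/take_uniq/enum_uniq.
- by move=> x /mem_take; rewrite mem_enum !inE => /andP[].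
- by move=> x /mem_take; rewrite mem_enum !inE => /andP[].
Qed.

Fixpoint weave (T : Type) (s t : seq T) : seq T :=
  match s, t with
  | a :: s', b :: t' => a :: b :: weave s' t'
  | _, _ => [::]
  end.

Lemma perm_weave (T : eqType) (s t : seq T) : size s = size t -> perm_eq (weave s t) (s ++ t).
Proof.
elim: s t => [|a s IH] [|b t] //= [/IH h].
by rewrite perm_cons (perm_trans (y := b :: s ++ t)) ?perm_cons // perm_sym -cat1s perm_catCA.
Qed.

Lemma perm_exchange (T : eqType) (x y : T) (A B : seq T) :
  perm_eq (x :: A ++ y :: B) (y :: A ++ x :: B).
Proof. by apply/permP => a; rewrite /= !count_cat /= addnCA [RHS]addnCA; congr addn; lia. Qed.

(** The number of cut arcs read off the word of classes of a path, where 1 stands for [S] and 2 for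
    [T]. Once the classes of the explicit nodes are known, tightness becomes a computation on a
    concrete word. *)
Fixpoint cuts (w : seq nat) : nat :=
  match w with
  | a :: ((b :: _) as w') => ((a == 1) && (b == 2) + cuts w')%N
  | _ => 0
  end.

Section Sufficiency.
Variables (R : realType) (n p m : nat) (Rs S T : {set node n}).
Hypothesis part : forall x, ((x \in Rs) + (x \in S) + (x \in T) = 1)%N.
Hypothesis T0 : ord0 \in T.
Hypothesis Tn : ord_max \in T.
Hypothesis p4 : (4 <= p)%N.
Hypothesis pn : (p <= n - 1)%N.
Hypothesis m1 : (0 < m)%N.
Hypothesis pE : p = (2 * m + 1 + #|Rs|)%N.
Hypothesis Sm : (m < #|S|)%N.
Hypothesis Tm : (m < #|T :\ ord0|)%N.
Implicit Types (A B U : seq (node n)) (i j s t u v w x y z : node n) (f : node n -> node n -> R).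

Local Notation g := (maxcut_weight R Rs S T).
Local Notation b := ((p + #|Rs|)./2).
Local Notation tight := (tight p Rs S T).
Local Notation ncut := (ncut S T).

(* The letter of a node: 0 for [R], 1 for [S], 2 for [T]. *)
Definition cls x : nat := if x \in Rs then 0 else if x \in S then 1 else 2.

Lemma clsR x : (x \in Rs) = (cls x == 0).
Proof. by rewrite /cls; case: (x \in Rs); case: (x \in S). Qed.

Lemma clsS x : (x \in S) = (cls x == 1).
Proof. by have := part x; rewrite /cls; case: (x \in Rs); case: (x \in S); case: (x \in T). Qed.

Lemma clsT x : (x \in T) = (cls x == 2).
Proof. by have := part x; rewrite /cls; case: (x \in Rs); case: (x \in S); case: (x \in T). Qed.

Lemma cls0 : cls ord0 = 2. Proof. by apply/eqP; rewrite -clsT. Qed.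
Lemma clsn : cls ord_max = 2. Proof. by apply/eqP; rewrite -clsT. Qed.

Lemma ncut_cons2 x y l : ncut [:: x, y & l] = ((x \in S) && (y \in T) + ncut (y :: l))%N.
Proof. by []. Qed.

Lemma ncutE l : ncut l = cuts (map cls l).
Proof.
elim: l => // x [|y l] // IH; rewrite ncut_cons2 IH /=.
by rewrite clsS clsT.
Qed.

Lemma count_clsE (a : nat) (A : {set node n}) l : (forall x, (x \in A) = (cls x == a)) ->
  count [in A] l = count_mem a (map cls l).
Proof. by move=> h; rewrite count_map; apply: eq_count => x /=; rewrite h. Qed.

Lemma ncut_cons x l : x \notin S -> ncut (x :: l) = ncut l.
Proof. by case: l => // y l /negbTE xS; rewrite ncut_cons2 xS. Qed.

Lemma ncut_cat x A l : last x A \notin S -> ncut (x :: A ++ l) = (ncut (x :: A) + ncut l)%N.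
Proof.
elim: A x => [|y A IH] x /= h; first by rewrite ncut_cons.
by rewrite !ncut_cons2 IH // addnA.
Qed.

(** The filler lists the nodes of [Rs] outside [U] and then alternates between [S] and [T]. It never
    ends in [S], so it creates no cut arc with what follows. The two counting hypotheses hold [k]
    within the at least [m + 1] nodes available in [S] and in [T] without node 0. *)
Lemma filler_exists U (k : nat) : uniq U -> ord0 \notin U ->
  (count_mem 1 (map cls U) + k <= m.+1)%N -> (count_mem 2 (map cls U) + k <= m.+1)%N ->
  exists q, [/\ uniq q, {in q, forall x, x \notin ord0 :: U},
    size q = (#|Rs| - count [in Rs] U + 2 * k)%N,
    count [in Rs] q = (#|Rs| - count [in Rs] U)%N
    & forall l, ncut (q ++ l) = (k + ncut l)%N].
Proof.
move=> uU U0; rewrite -(count_clsE U clsS) -(count_clsE U clsT) => hS hT.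
have [|ss [zs us sS sU]] := @free_elts _ S U k uU; first by apply: leq_trans Sm.
have [|ts [zt ut sT tU]] := @free_elts _ (T :\ ord0) U k uU.
  apply: leq_trans Tm; rewrite (eq_in_count (a2 := [in T])) // => x xU.
  by rewrite !inE; case: eqP => // x0; rewrite x0 (negbTE U0) in xU.
have [|rs [zr ur sR rU]] := @free_elts _ Rs U (#|Rs| - count [in Rs] U) uU.
  by rewrite subnKC // count_set_le.
have pw : perm_eq (weave ss ts) (ss ++ ts) by apply: perm_weave; rewrite zs zt.
have rS x : x \in rs -> (x \notin S) && (x \notin T).
  by move/sR; have := part x; case: (x \in Rs); case: (x \in S); case: (x \in T).
have tS x : x \in ts -> x \in T /\ x \notin S.
  by move/sT; rewrite inE => /andP[_]; have := part x;
    case: (x \in Rs); case: (x \in S); case: (x \in T).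
have sTT x : x \in ss -> (x \notin T) && (x \notin Rs).
  by move/sS; have := part x; case: (x \in Rs); case: (x \in S); case: (x \in T).
have tR x : x \in ts -> x \notin Rs.
  by move/sT; rewrite inE => /andP[_]; have := part x;
    case: (x \in Rs); case: (x \in S); case: (x \in T).
exists (rs ++ weave ss ts); split.
- rewrite cat_uniq ur (perm_uniq pw) cat_uniq us ut andbT /=; apply/andP; split.
    apply/hasPn => x; rewrite (perm_mem pw) mem_cat => /orP[] h; apply/negP => /rS.
      by rewrite (sS _ h).
    by rewrite (tS _ h).1 andbF.
  by apply/hasPn => x /tS[xT _]; apply/negP => /sTT; rewrite xT.
- move=> x; rewrite inE negb_or mem_cat (perm_mem pw) mem_cat => /or3P[] h.
  + rewrite rU // andbT; apply: contraTneq T0 => <-; by case/andP: (rS _ h).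
  + rewrite sU // andbT; apply: contraTneq T0 => <-; by case/andP: (sTT _ h).
  + by rewrite tU // andbT; move: (sT _ h); rewrite !inE => /andP[].
- by rewrite size_cat zr (perm_size pw) size_cat zs zt; lia.
- rewrite count_cat (permP pw) count_cat.
  have -> : count [in Rs] rs = size rs by apply/eqP; rewrite -all_count; apply/allP.
  rewrite zr; have -> : count [in Rs] ss = 0%N.
    by apply/eqP; rewrite -leqn0 leqNgt -has_count; apply/hasPn => x /sTT /andP[].
  have -> : count [in Rs] ts = 0%N.
    by apply/eqP; rewrite -leqn0 leqNgt -has_count; apply/hasPn => x /tR.
  by rewrite !addn0.
- move=> l; rewrite -catA.
  have -> q : ncut (rs ++ q) = ncut q.
    elim: (rs) rS => //= x r IH rS; rewrite ncut_cons.
      by apply: IH => y yr; apply: rS; rewrite inE yr orbT.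
    by have := rS x; rewrite inE eqxx => /(_ isT)/andP[].
  have : {subset ss <= S} by [].
  elim: (ss) (ts) k zs zt tS {sS sT us ut sU tU pw hS hT sTT tR}
    => [|a s IH] [|b t] [|k] //= [zs] [zt] tS sS.
  have [bT bS] := tS b (mem_head _ _).
  rewrite ncut_cons2 ncut_cons // (IH t k) // => [|x xt|x xs].
  + by rewrite bT sS ?mem_head.
  + by apply: tS; rewrite inE xt orbT.
  + by apply: sS; rewrite inE xs orbT.
Qed.

(** The last two equations state that the path has [p = 2m + 1 + #|Rs|] arcs and reaches the bound
    [m + #|Rs|], with the contribution [#|Rs|] of nodes outside the explicit part cancelled. A node
    of [U] in [Rs] that is not on the path is the one that a tight path may omit. *)
Lemma tight_build U (k : nat) q A B :
  {in q, forall x, x \notin ord0 :: U} -> uniq q ->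
  size q = (#|Rs| - count [in Rs] U + 2 * k)%N ->
  count [in Rs] q = (#|Rs| - count [in Rs] U)%N ->
  (forall l, ncut (q ++ l) = (k + ncut l)%N) -> uniq U -> {subset A ++ B <= U} ->
  uniq (ord0 :: A ++ B) -> last ord0 B = ord_max -> B != [::] -> last 2 (map cls A) != 1%N ->
  (2 * k + size (A ++ B) = 2 * m + 1 + count_mem 0 (map cls U))%N ->
  (k + cuts (map cls (ord0 :: A)) + cuts (map cls B) + count_mem 0 (map cls (A ++ B)) =
     m + count_mem 0 (map cls U))%N ->
  tight (ord0 :: A ++ q ++ B).
Proof.
move=> qU uq sq cq nq uU sub uAB lB B0 lA hs hc.
have cU : (count [in Rs] U <= #|Rs|)%N by apply: count_set_le.
rewrite -(count_clsE U clsR) in hs hc; rewrite -(count_clsE (A ++ B) clsR) in hc.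
have hp : is_p_path p (ord0 :: A ++ q ++ B).
  apply: p_path_intro; first by lia.
  - by move: hs; rewrite !size_cat sq pE; lia.
  - have -> : ord0 :: A ++ q ++ B = (ord0 :: A) ++ q ++ B by [].
    rewrite uniq_catCA cat_uniq uq uAB andbT andTb.
    apply/hasPn => x; rewrite mem_cat inE -orbA -mem_cat => /orP[/eqP ->|/sub xU];
      apply/negP => /qU.
      by rewrite inE eqxx.
    by rewrite inE xU orbT.
  - by rewrite !last_cat; case: (B) lB B0.
rewrite /tight hp /= clsR cls0 /= add0n !count_cat.
have -> : ncut (ord0 :: A ++ q ++ B) = (ncut (ord0 :: A) + (k + ncut B))%N.
  rewrite ncut_cat ?nq // clsS; case: (A) lA => [|a l] //=; first by rewrite cls0.
  by rewrite last_map.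
rewrite !ncutE cq pE; apply/eqP.
move: hc cU; rewrite count_cat.
move: (count _ A) (count _ B) (count _ U) (cuts _) (cuts _) #|Rs| => a b u x y r; clear; lia.
Qed.

Lemma cls_neq x y : cls x != cls y -> x != y.
Proof. by apply: contraNneq => ->. Qed.

Definition inner_T x := [/\ cls x = 2%N, x != ord0 & x != ord_max].

Lemma fresh_S (l : seq (node n)) : (size l <= m)%N ->
  exists2 x, cls x = 1%N & all (fun y => x != y) l.
Proof.
move=> sl; have [|x xS xl] := @fresh_elt _ S l; first exact: leq_ltn_trans sl Sm.
exists x; first by apply/eqP; rewrite -clsS.
by apply/allP => y yl; apply: contraNneq xl => ->.
Qed.

Lemma fresh_T (l : seq (node n)) : (size l < m)%N ->
  exists2 x, inner_T x & all (fun y => x != y) l.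
Proof.
move=> sl; have [|x xT xl] := @fresh_elt _ (T :\ ord0 :\ ord_max) l.
  by apply: leq_trans sl _; rewrite -ltnS -(card_T_inner T0 Tn p4 pn).
move: xT; rewrite !inE clsT => /and3P[xn x0 /eqP xc].
exists x => //; by apply/allP => y yl; apply: contraNneq xl => ->.
Qed.

Lemma fresh_R (l : seq (node n)) : (size l < #|Rs|)%N ->
  exists2 x, cls x = 0%N & all (fun y => x != y) l.
Proof.
move=> sl; have [|x xR xl] := @fresh_elt _ Rs l; first exact: sl.
exists x; first by apply/eqP; rewrite -clsR.
by apply/allP => y yl; apply: contraNneq xl => ->.
Qed.

Definition inner_Y x := cls x = 0%N \/ cls x = 1%N.

Lemma inner_Y_neq x : inner_Y x -> (x != ord0) && (x != ord_max).
Proof. by case=> cx; apply/andP; split; apply: cls_neq; rewrite cx ?cls0 ?clsn. Qed.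

Lemma cls_inner x : x != ord0 -> x != ord_max -> [\/ cls x = 0%N, cls x = 1%N | inner_T x].
Proof.
move=> x0 xn; have : (cls x < 3)%N by rewrite /cls; case: (x \in Rs); case: (x \in S).
by case E : (cls x) => [|[|[|]]] // _; [apply: Or31 | apply: Or32 | apply: Or33].
Qed.

(** * Exchange relations from pairs of tight paths *)

Section Swaps.
Variables (c : node n -> node n -> R) (kappa : R).
Hypothesis c_tight : forall q, tight q -> wt c q = kappa.

(* The two paths share a filler made of all nodes of [R] outside [U] followed by [k] disjoint arcs
   [S -> T]. It follows node 0 here, and comes after the exchanged node in [swap_early]. *)
Lemma swap_late (pre post : seq (node n)) u v v' w (k : nat) :
  uniq [:: ord0, v' & pre ++ [:: u, v, w & post]] ->
  last w post = ord_max ->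
  let W x := map cls (pre ++ [:: u, x, w & post]) in
  let U := cls v' :: W v in
  (count_mem 1 U + k <= m.+1)%N -> (count_mem 2 U + k <= m.+1)%N ->
  (2 * k + size (W v) = 2 * m + 1 + count_mem 0 U)%N ->
  (k + cuts (W v) + count_mem 0 (W v) = m + count_mem 0 U)%N ->
  (k + cuts (W v') + count_mem 0 (W v') = m + count_mem 0 U)%N ->
  c u v + c v w = c u v' + c v' w.
Proof.
move=> uU lw W U h1 h2 h3 h4 h5.
pose V := v' :: pre ++ [:: u, v, w & post].
have uV : uniq V by case/andP: uU.
have UV : map cls V = U by [].
have V0 : ord0 \notin V by case/andP: uU.
have [q [uq qV sq cq nq]] := filler_exists (k := k) uV V0 h1 h2.
have pV : perm_eq V (v :: pre ++ [:: u, v', w & post]).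
  by have := perm_exchange v' v (rcons pre u) (w :: post); rewrite !cat_rcons.
have u' : uniq [:: ord0, v & pre ++ [:: u, v', w & post]].
  by rewrite -(perm_uniq (s1 := ord0 :: V)) // perm_cons.
have tgt x : x \in [:: v; v'] -> tight (ord0 :: q ++ pre ++ [:: u, x, w & post]).
  rewrite !inE => xv.
  apply: (@tight_build V k q [::]) => //.
  - case/orP: xv => /eqP -> y yB; first by rewrite /V inE yB orbT.
    by rewrite (perm_mem pV) inE yB orbT.
  - case/orP: xv => /eqP ->; [move: uU | move: u'] => /= /andP[+ /andP[_ ->]]; rewrite andbT.
      by rewrite inE negb_or => /andP[].
    by rewrite inE negb_or => /andP[].
  - by rewrite last_cat.
  - by case: (pre).
  - by move: h3; rewrite UV /W !size_map !size_cat.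
  - rewrite UV [cuts (map cls [:: ord0])]/= addn0.
    by case/orP: xv => /eqP ->.
have := c_tight (tgt v _); have := c_tight (tgt v' _).
rewrite !inE !eqxx orbT => /(_ isT) e1 /(_ isT) e2; move: e1 e2.
have sp x : ord0 :: q ++ pre ++ [:: u, x, w & post] =
    rcons (ord0 :: q ++ pre) u ++ [:: x, w & post].
  by rewrite cat_rcons /= catA.
rewrite !sp !wt_split; lra.
Qed.

Lemma swap_early (l B : seq (node n)) v v' w (k : nat) :
  uniq [:: ord0, v', v, w & l ++ B] ->
  last ord0 B = ord_max -> B != [::] ->
  let W x := map cls [:: x, w & l ++ B] in
  let U := cls v' :: W v in
  last (cls w) (map cls l) != 1%N ->
  (count_mem 1 U + k <= m.+1)%N -> (count_mem 2 U + k <= m.+1)%N ->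
  (2 * k + size (W v) = 2 * m + 1 + count_mem 0 U)%N ->
  (k + cuts (2%N :: map cls [:: v, w & l]) + cuts (map cls B) + count_mem 0 (W v) =
    m + count_mem 0 U)%N ->
  (k + cuts (2%N :: map cls [:: v', w & l]) + cuts (map cls B) + count_mem 0 (W v') =
    m + count_mem 0 U)%N ->
  c ord0 v + c v w = c ord0 v' + c v' w.
Proof.
move=> uU lB B0 W U lA h1 h2 h3 h4 h5.
pose V := [:: v', v, w & l ++ B].
have uV : uniq V by case/andP: uU.
have UV : map cls V = U by [].
have V0 : ord0 \notin V by case/andP: uU.
have [q [uq qV sq cq nq]] := filler_exists (k := k) uV V0 h1 h2.
have pV : perm_eq V [:: v, v', w & l ++ B] by apply: (perm_exchange v' v [::]).
have u' : uniq [:: ord0, v, v', w & l ++ B].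
  by rewrite -(perm_uniq (s1 := ord0 :: V)) // perm_cons.
have tgt x : x \in [:: v; v'] -> tight (ord0 :: [:: x, w & l] ++ q ++ B).
  rewrite !inE => xv.
  apply: (@tight_build V k q [:: x, w & l]) => //.
  - case/orP: xv => /eqP -> y yB; first by rewrite /V inE yB orbT.
    by rewrite (perm_mem pV) inE yB orbT.
  - case/orP: xv => /eqP ->; [move: uU | move: u'] => /= /andP[+ /andP[_ ->]]; rewrite andbT.
      by rewrite inE negb_or => /andP[].
    by rewrite inE negb_or => /andP[].
  - by move: h3; rewrite UV /W !size_map.
  - by rewrite UV [map cls (ord0 :: _)]/= cls0; case/orP: xv => /eqP ->.
have := c_tight (tgt v _); have := c_tight (tgt v' _).
rewrite !inE !eqxx orbT => /(_ isT) e1 /(_ isT) e2; move: e1 e2.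
have sp x : ord0 :: [:: x, w & l] ++ q ++ B = rcons [::] ord0 ++ [:: x, w & l ++ q ++ B] by [].
rewrite !sp !wt_split; lra.
Qed.

Ltac cls_rw := repeat match goal with H : cls _ = _ |- _ => rewrite !H end.
Ltac neq_tac := first [ done | assumption | by rewrite eq_sym
  | exact: (ord0_neq_max T0 Tn p4 pn)
  | by apply: cls_neq; rewrite ?cls0 ?clsn; cls_rw ].
Ltac swap_tac := first [ done
  | by rewrite /= !inE !negb_or; repeat (apply/andP; split); neq_tac
  | by rewrite /= ?cls0 ?clsn; cls_rw; rewrite /=; nlia ].

(* In [swap_UVWX] the node [v] of class [V] is replaced by a node of class [W] between nodes of
   classes [U] and [X]; the letters [0] and [n] stand for the end nodes. The last argument of
   [swap_late] and [swap_early] is the number of additional disjoint arcs [S -> T]. *)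
Lemma swap_STTS s t t' x :
  (1 < m)%N -> cls s = 1%N -> inner_T t -> inner_T t' -> cls x = 1%N -> s != x -> t != t' ->
  c s t + c t x = c s t' + c t' x.
Proof.
move=> m2 cs [ct t0 tn] [ct' t'0 t'n] cx sx tt'.
have [|y cy /= /and3P[ys yx _]] := @fresh_S [:: s; x]; first by [].
(* The word SSTST of [y], [s], [t], [x], [n] has two cut arcs, so [m - 2] are added; the unmatched
   [y] brings the length to the required [2m + 1]. *)
by apply: (@swap_late [:: y] [:: ord_max] _ _ _ _ (m - 2)); swap_tac.
Qed.

Lemma swap_STRS s t i x :
  cls s = 1%N -> inner_T t -> cls i = 0%N -> cls x = 1%N -> s != x ->
  c s t + c t x = c s i + c i x.
Proof.
move=> cs [ct t0 tn] ci cx sx.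
by apply: (@swap_late [::] [:: ord_max] _ _ _ _ (m - 1)); swap_tac.
Qed.

Lemma swap_STRR s t i x :
  cls s = 1%N -> inner_T t -> cls i = 0%N -> cls x = 0%N -> i != x ->
  c s t + c t x = c s i + c i x.
Proof.
move=> cs [ct t0 tn] ci cx ix.
have [|y cy /= /andP[ys _]] := @fresh_S [:: s]; first by [].
by apply: (@swap_late [::] [:: y; ord_max] _ _ _ _ (m - 1)); swap_tac.
Qed.

Lemma swap_SSTn s v t :
  cls s = 1%N -> cls v = 1%N -> inner_T t -> s != v ->
  c s v + c v ord_max = c s t + c t ord_max.
Proof.
move=> cs cv [ct t0 tn] sv.
by apply: (@swap_late [::] [::] _ _ _ _ (m - 1)); swap_tac.
Qed.

Lemma swap_SSTT s v t z :
  (1 < m)%N -> cls s = 1%N -> cls v = 1%N -> inner_T t -> inner_T z -> s != v -> t != z ->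
  c s v + c v z = c s t + c t z.
Proof.
move=> m2 cs cv [ct t0 tn] [cz z0 zn] sv tz.
have [|y cy /= /and3P[ys yv _]] := @fresh_S [:: s; v]; first by [].
by apply: (@swap_late [::] [:: y; ord_max] _ _ _ _ (m - 2)); swap_tac.
Qed.

Lemma swap_TSSn t v s :
  inner_T t -> cls v = 1%N -> cls s = 1%N -> v != s ->
  c t v + c v ord_max = c t s + c s ord_max.
Proof.
move=> [ct t0 tn] cv cs vs.
by apply: (@swap_late [::] [::] _ _ _ _ (m - 1)); swap_tac.
Qed.

Lemma swap_TSST t v s z :
  (1 < m)%N -> inner_T t -> cls v = 1%N -> cls s = 1%N -> inner_T z -> t != z -> v != s ->
  c t v + c v z = c t s + c s z.
Proof.
move=> m2 [ct t0 tn] cv cs [cz z0 zn] tz vs.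
have [|y cy /= /and3P[yv ys _]] := @fresh_S [:: v; s]; first by [].
by apply: (@swap_late [::] [:: y; ord_max] _ _ _ _ (m - 2)); swap_tac.
Qed.

Lemma swap_RSSn i v s :
  cls i = 0%N -> cls v = 1%N -> cls s = 1%N -> v != s ->
  c i v + c v ord_max = c i s + c s ord_max.
Proof.
move=> ci cv cs vs.
have [|y [cy y0 yn] /= _] := @fresh_T [::]; first by [].
by apply: (@swap_late [:: y] [::] _ _ _ _ (m - 1)); swap_tac.
Qed.

Lemma swap_RSST i v s z :
  cls i = 0%N -> cls v = 1%N -> cls s = 1%N -> inner_T z -> v != s ->
  c i v + c v z = c i s + c s z.
Proof.
move=> ci cv cs [cz z0 zn] vs.
by apply: (@swap_late [::] [:: ord_max] _ _ _ _ (m - 1)); swap_tac.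
Qed.

Lemma swap_RSTS i v t x :
  cls i = 0%N -> cls v = 1%N -> inner_T t -> cls x = 1%N -> v != x ->
  c i v + c v x = c i t + c t x.
Proof.
move=> ci cv [ct t0 tn] cx vx.
by apply: (@swap_late [::] [:: ord_max] _ _ _ _ (m - 1)); swap_tac.
Qed.

Lemma swap_RSTR i v t x :
  cls i = 0%N -> cls v = 1%N -> inner_T t -> cls x = 0%N -> i != x ->
  c i v + c v x = c i t + c t x.
Proof.
move=> ci cv [ct t0 tn] cx ix.
have [|y cy /= /andP[yv _]] := @fresh_S [:: v]; first by [].
by apply: (@swap_late [::] [:: y; ord_max] _ _ _ _ (m - 1)); swap_tac.
Qed.

Lemma swap_TSTS u v t x :
  (1 < m)%N -> inner_T u -> cls v = 1%N -> inner_T t -> cls x = 1%N -> u != t -> v != x ->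
  c u v + c v x = c u t + c t x.
Proof.
move=> m2 [cu u0 un] cv [ct t0 tn] cx ut vx.
have [|y cy /= /and3P[yv yx _]] := @fresh_S [:: v; x]; first by [].
by apply: (@swap_late [:: y] [:: ord_max] _ _ _ _ (m - 2)); swap_tac.
Qed.

Lemma swap_TSTR u v t x :
  (1 < m)%N -> inner_T u -> cls v = 1%N -> inner_T t -> cls x = 0%N -> u != t ->
  c u v + c v x = c u t + c t x.
Proof.
move=> m2 [cu u0 un] cv [ct t0 tn] cx ut.
have [|y cy /= /andP[yv _]] := @fresh_S [:: v]; first by [].
have [|z cz /= /and3P[zv zy _]] := @fresh_S [:: v; y]; first by [].
by apply: (@swap_late [:: y] [:: z; ord_max] _ _ _ _ (m - 2)); swap_tac.
Qed.

Lemma swap_0STR v t x :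
  cls v = 1%N -> inner_T t -> cls x = 0%N ->
  c ord0 v + c v x = c ord0 t + c t x.
Proof.
move=> cv [ct t0 tn] cx.
have [|y cy /= /andP[yv _]] := @fresh_S [:: v]; first by [].
by apply: (@swap_early [::] [:: y; ord_max] _ _ _ (m - 1)); swap_tac.
Qed.

Lemma swap_0STS v t x :
  (1 < m)%N -> cls v = 1%N -> inner_T t -> cls x = 1%N -> v != x ->
  c ord0 v + c v x = c ord0 t + c t x.
Proof.
move=> m2 cv [ct t0 tn] cx vx.
have [|u [cu u0 un] /= /andP[ut _]] := @fresh_T [:: t]; first by [].
have [|y cy /= /and3P[yv yx _]] := @fresh_S [:: v; x]; first by [].
by apply: (@swap_early [:: u] [:: y; ord_max] _ _ _ (m - 2)); swap_tac.
Qed.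

Lemma swap_TSRn t v i :
  inner_T t -> cls v = 1%N -> cls i = 0%N ->
  c t v + c v ord_max = c t i + c i ord_max.
Proof.
move=> [ct t0 tn] cv ci.
have [|y cy /= /andP[yv _]] := @fresh_S [:: v]; first by [].
by apply: (@swap_late [:: y] [::] _ _ _ _ (m - 1)); swap_tac.
Qed.

Lemma swap_RSRT j v i z :
  cls j = 0%N -> cls v = 1%N -> cls i = 0%N -> inner_T z -> j != i ->
  c j v + c v z = c j i + c i z.
Proof.
move=> cj cv ci [cz z0 zn] ji.
have [|y cy /= /andP[yv _]] := @fresh_S [:: v]; first by [].
by apply: (@swap_late [::] [:: y; ord_max] _ _ _ _ (m - 1)); swap_tac.
Qed.

Lemma swap_TSRT t v i z :
  (1 < m)%N -> inner_T t -> cls v = 1%N -> cls i = 0%N -> inner_T z -> t != z ->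
  c t v + c v z = c t i + c i z.
Proof.
move=> m2 [ct t0 tn] cv ci [cz z0 zn] tz.
have [|y cy /= /andP[yv _]] := @fresh_S [:: v]; first by [].
have [|x cx /= /and3P[xv xy _]] := @fresh_S [:: v; y]; first by [].
(* With [v] the word is STSTST and the path omits [i], so it has [m + 1] cut arcs; putting [i] in
   place of [v] trades one cut arc for a visit to [Rs]. Hence [m - 2] again, despite three cut arcs
   in the word. *)
by apply: (@swap_late [:: y] [:: x; ord_max] _ _ _ _ (m - 2)); swap_tac.
Qed.

Lemma swap_0SST v s z :
  cls v = 1%N -> cls s = 1%N -> inner_T z -> v != s ->
  c ord0 v + c v z = c ord0 s + c s z.
Proof.
move=> cv cs [cz z0 zn] vs.
by apply: (@swap_early [::] [:: ord_max] _ _ _ (m - 1)); swap_tac.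
Qed.

Lemma swap_0SRT v i z :
  cls v = 1%N -> cls i = 0%N -> inner_T z ->
  c ord0 v + c v z = c ord0 i + c i z.
Proof.
move=> cv ci [cz z0 zn].
have [|y cy /= /andP[yv _]] := @fresh_S [:: v]; first by [].
by apply: (@swap_early [::] [:: y; ord_max] _ _ _ (m - 1)); swap_tac.
Qed.

(** * Solving the exchange relations *)

(** The relations fix all values in terms of [a], [b], [e]. From [Rs] or inner [T], [c] is [a + b]
    into [s0], [a] into the rest of [Rs] and [S], and [b] into [T]. From [S] without [s0] it is [2b]
    into [s0] and [b] elsewhere. From node 0 it is [e] into [s0], [e - a] into inner [T] and [e - b]
    into the rest. *)
Lemma normal_form s0 : cls s0 = 1%N ->
  (1 < m)%N \/ (forall t t', inner_T t -> inner_T t' -> t = t') /\ (1 < #|Rs|)%N ->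
  (forall j, j != ord0 -> j != s0 -> c s0 j = 0) ->
  exists (pi : node n -> R) (lam mu : R), forall i j, is_arc (i, j) ->
    c i j = pi i - pi j + (lam + mu * maxcut_weight R Rs S T i j).
Proof.
move=> cs0 hcase zs.
have [|s1 cs1 /andP[s10 _]] := @fresh_S [:: s0]; first by [].
have [|t0 It0 _] := @fresh_T [::]; first by [].
have s01 : s0 != s1 by rewrite eq_sym.
pose a := c t0 s1; pose b := c t0 s0 - a; pose e := c ord0 s0.
have zY x : inner_Y x -> x != s0 -> c s0 x = 0.
  by move=> /inner_Y_neq /andP[x0 _] xs; apply: zs.
have zT t : inner_T t -> c s0 t = 0.
  by case=> ct t1 _; apply: zs => //; apply: cls_neq; rewrite ct cs0.
have zn : c s0 ord_max = 0.
  by apply: zs; [rewrite eq_sym (ord0_neq_max T0 Tn p4 pn) | apply: cls_neq; rewrite clsn cs0].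
have Y1 : inner_Y s1 by right.
have tY t x : inner_T t -> inner_Y x -> x != s0 -> c t x = c t s1.
  move=> It Yx xs0; have sx0 : s0 != x by rewrite eq_sym.
  case: hcase => [m2|[_ r2]].
    have [|u Iu /andP[ut _]] := @fresh_T [:: t]; first by [].
    have k y : inner_Y y -> y != s0 -> s0 != y -> c u s0 + c s0 y = c u t + c t y.
      by case=> cy ys sy; [apply: swap_TSTR | apply: swap_TSTS].
    have := k x Yx xs0 sx0; have := k s1 Y1 s10 s01.
    by rewrite !zY //; lra.
  (* For [m = 1] a node [i] of [Rs] replaces the auxiliary inner node [u] of [T]. It must differ
     from [x], which may itself lie in [Rs]; hence the need for two nodes there. *)
  have [|i ci /andP[ix _]] := @fresh_R [:: x]; first by [].
  have k y : inner_Y y -> y != s0 -> s0 != y -> i != y -> c i s0 + c s0 y = c i t + c t y.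
    by case=> cy ys sy iy; [apply: swap_RSTR | apply: swap_RSTS].
  have := k x Yx xs0 sx0 ix; have := k s1 Y1 s10 s01.
  have is1 : i != s1 by apply: cls_neq; rewrite ci cs1.
  by rewrite !zY // => /(_ is1); lra.
have ta t : inner_T t -> c t s1 = a.
  move=> It; have [->|tt] := eqVneq t t0; first by [].
  case: hcase => [m2|[h _]]; last by rewrite (h _ _ It It0) eqxx in tt.
  have := swap_STTS m2 cs0 It It0 cs1 s01 tt.
  by rewrite !zT // /a; lra.
have tx t x : inner_T t -> inner_Y x -> x != s0 -> c t x = a.
  by move=> It Yx xs; rewrite tY // ta.
have ix i x : cls i = 0%N -> inner_Y x -> x != s0 -> i != x -> c i x = a.
  move=> ci Yx xs nix; have sx : s0 != x by rewrite eq_sym.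
  have Yi : inner_Y i by left.
  have is0 : i != s0 by apply: cls_neq; rewrite ci cs0.
  have : c s0 t0 + c t0 x = c s0 i + c i x.
    by case: (Yx) => cx; [apply: swap_STRR | apply: swap_STRS].
  by rewrite zT // zY // tx //; lra.
have YS s : cls s = 1%N -> inner_Y s by right.
have YR i : cls i = 0%N -> inner_Y i by left.
have RS i s : cls i = 0%N -> cls s = 1%N -> i != s.
  by move=> ci cs; apply: cls_neq; rewrite ci cs.
have sn s : cls s = 1%N -> s != s0 -> c s ord_max = b.
  move=> cs ss; have s0s : s0 != s by rewrite eq_sym.
  have := swap_TSSn It0 cs0 cs s0s; rewrite zn (tx _ _ It0 (YS _ cs) ss).
  by rewrite /b; lra.
have ts0 t : inner_T t -> c t s0 = a + b.
  move=> It; have := swap_TSSn It cs0 cs1 s01.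
  by rewrite zn (tx _ _ It Y1 s10) (sn _ cs1 s10); lra.
have is0 i : cls i = 0%N -> c i s0 = a + b.
  move=> ci; have := swap_RSSn ci cs0 cs1 s01.
  by rewrite zn (ix _ _ ci Y1 s10 (RS _ _ ci cs1)) (sn _ cs1 s10); lra.
have sz s z : cls s = 1%N -> s != s0 -> inner_T z -> c s z = b.
  move=> cs ss Iz; have s0s : s0 != s by rewrite eq_sym.
  case: hcase => [m2|[h r2]].
    have [|t It /andP[tz _]] := @fresh_T [:: z]; first by [].
    have := swap_TSST m2 It cs0 cs Iz tz s0s.
    by rewrite (zT _ Iz) (ts0 _ It) (tx _ _ It (YS _ cs) ss); lra.
  have [|i ci _] := @fresh_R [::]; first by apply: ltnW.
  have := swap_RSST ci cs0 cs Iz s0s.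
  by rewrite (zT _ Iz) (is0 _ ci) (ix _ _ ci (YS _ cs) ss (RS _ _ ci cs)); lra.
have tn t : inner_T t -> c t ord_max = b.
  move=> It; have := swap_SSTn cs0 cs1 It s01.
  by rewrite (zY _ Y1 s10) (zT _ It) (sn _ cs1 s10); lra.
have tz t z : inner_T t -> inner_T z -> t != z -> c t z = b.
  move=> It Iz ntz; case: hcase => [m2|[h _]]; last by rewrite (h _ _ It Iz) eqxx in ntz.
  have := swap_SSTT m2 cs0 cs1 It Iz s01 ntz.
  by rewrite (zY _ Y1 s10) (zT _ It) (sz _ _ cs1 s10 Iz); lra.
have in_ i : cls i = 0%N -> c i ord_max = b.
  move=> ci; have := swap_TSRn It0 cs0 ci.
  by rewrite zn (ts0 _ It0) (tx _ _ It0 (YR _ ci) (RS _ _ ci cs0)); lra.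
have iz i z : cls i = 0%N -> inner_T z -> c i z = b.
  move=> ci Iz; have is_ := RS _ _ ci cs0.
  case: hcase => [m2|[h r2]].
    have [|t It /andP[ntz _]] := @fresh_T [:: z]; first by [].
    have := swap_TSRT m2 It cs0 ci Iz ntz.
    by rewrite (zT _ Iz) (ts0 _ It) (tx _ _ It (YR _ ci) is_); lra.
  have [|j cj /andP[ji _]] := @fresh_R [:: i]; first by [].
  have := swap_RSRT cj cs0 ci Iz ji.
  by rewrite (zT _ Iz) (is0 _ cj) (ix _ _ cj (YR _ ci) is_ ji); lra.
have ot t : inner_T t -> c ord0 t = e - a.
  move=> It; case: hcase => [m2|[h r2]].
    have := swap_0STS m2 cs0 It cs1 s01.
    by rewrite (zY _ Y1 s10) (tx _ _ It Y1 s10) -/e; lra.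
  have [|i ci _] := @fresh_R [::]; first by apply: ltnW.
  have is_ := RS _ _ ci cs0; have := swap_0STR cs0 It ci.
  by rewrite (zY _ (YR _ ci) is_) (tx _ _ It (YR _ ci) is_) -/e; lra.
have oY x : inner_Y x -> x != s0 -> c ord0 x = e - b.
  move=> Yx xs; have sx : s0 != x by rewrite eq_sym.
  case: (Yx) => cx.
    by have := swap_0SRT cs0 cx It0; rewrite (zT _ It0) (iz _ _ cx It0) -/e; lra.
  by have := swap_0SST cs0 cx It0 sx; rewrite (zT _ It0) (sz _ _ cx xs It0) -/e; lra.
have ss0 s : cls s = 1%N -> s != s0 -> c s s0 = 2 * b.
  move=> cs ns; have := swap_SSTn cs cs0 It0 ns.
  by rewrite zn (sz _ _ cs ns It0) (tn _ It0); lra.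
have ss s s' : cls s = 1%N -> s != s0 -> cls s' = 1%N -> s' != s0 -> s != s' -> c s s' = b.
  move=> cs ns cs' ns' nss; have := swap_SSTn cs cs' It0 nss.
  by rewrite (sn _ cs' ns') (sz _ _ cs ns It0) (tn _ It0); lra.
have si s i : cls s = 1%N -> s != s0 -> cls i = 0%N -> c s i = b.
  move=> cs ns ci; have := swap_STRS cs It0 ci cs0 ns.
  by rewrite (sz _ _ cs ns It0) (ts0 _ It0) (is0 _ ci); lra.
have s00 : s0 != ord0 by apply: cls_neq; rewrite cs0 cls0.
have s0n : s0 != ord_max by apply: cls_neq; rewrite cs0 clsn.
(* Forced by the desired form: with [pi s0 = 0], [lam = b] and [mu = a - b], the vanishing of [c] on
   the arcs out of [s0] gives [b] on [Rs] and [S] and [a] on [T], and the arc from 0 to [s0] gives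
   [e - b] at node 0. *)
pose pi x := if x == ord0 then e - b else if x == s0 then 0 else if cls x == 2%N then a else b.
have pi0 : pi ord0 = e - b by rewrite /pi eqxx.
have pis0 : pi s0 = 0 by rewrite /pi eqxx (negbTE s00).
have piY x : inner_Y x -> x != s0 -> pi x = b.
  move=> Yx xs; rewrite /pi (negbTE xs); case/andP: (inner_Y_neq Yx) => /negbTE -> _.
  by case: Yx => ->.
have piT x : inner_T x -> pi x = a.
  case=> cx /negbTE x0 _; rewrite /pi x0 cx eqxx.
  by case: eqP cx => // ->; rewrite cs0.
have pin : pi ord_max = a.
  by rewrite /pi clsn eqxx eq_sym (negbTE (ord0_neq_max T0 Tn p4 pn)) eq_sym (negbTE s0n).
exists pi, b, (a - b) => i j.
rewrite /is_arc /maxcut_weight clsS clsT clsR /= => /and4P[nij j0 in0 nonn].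
have [ei|i0] := eqVneq i ord0.
  rewrite ei eqxx /= in nonn *; rewrite cls0 pi0.
  have [ej|js] := eqVneq j s0; first by rewrite ej pis0 cs0 -/e /=; lra.
  case: (cls_inner j0 nonn) => cj.
  - by rewrite (oY _ (YR _ cj) js) (piY _ (YR _ cj) js) /=; lra.
  - by rewrite (oY _ (YS _ cj) js) (piY _ (YS _ cj) js) /=; lra.
  - by rewrite (ot _ cj) (piT _ cj) /=; lra.
have [ei|is_] := eqVneq i s0.
  rewrite ei cs0 pis0; rewrite ei eq_sym in nij; rewrite (zs _ j0 nij).
  have [ej|jn] := eqVneq j ord_max; first by rewrite ej pin clsn /=; lra.
  case: (cls_inner j0 jn) => cj.
  - by rewrite (piY _ (YR _ cj) nij) cj /=; lra.
  - by rewrite (piY _ (YS _ cj) nij) cj /=; lra.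
  - by rewrite (piT _ cj); case: cj => -> _ _ /=; lra.
have [ej|jn] := eqVneq j ord_max.
  rewrite ej pin clsn; case: (cls_inner i0 in0) => ci.
  - by rewrite (in_ _ ci) (piY _ (YR _ ci) is_) ci /=; lra.
  - by rewrite (sn _ ci is_) (piY _ (YS _ ci) is_) ci /=; lra.
  - by rewrite (tn _ ci) (piT _ ci); case: ci => -> _ _ /=; lra.
have [ej|js] := eqVneq j s0.
  rewrite ej pis0 cs0; case: (cls_inner i0 in0) => ci.
  - by rewrite (is0 _ ci) (piY _ (YR _ ci) is_) ci /=; lra.
  - by rewrite (ss0 _ ci is_) (piY _ (YS _ ci) is_) ci /=; lra.
  - by rewrite (ts0 _ ci) (piT _ ci); case: ci => -> _ _ /=; lra.
case: (cls_inner i0 in0) => ci; case: (cls_inner j0 jn) => cj.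
- by rewrite (ix _ _ ci (YR _ cj) js nij) (piY _ (YR _ ci) is_) (piY _ (YR _ cj) js) ci cj /=; lra.
- by rewrite (ix _ _ ci (YS _ cj) js nij) (piY _ (YR _ ci) is_) (piY _ (YS _ cj) js) ci cj /=; lra.
- by rewrite (iz _ _ ci cj) (piY _ (YR _ ci) is_) (piT _ cj) ci; case: cj => -> _ _ /=; lra.
- by rewrite (si _ _ ci is_ cj) (piY _ (YS _ ci) is_) (piY _ (YR _ cj) js) ci cj /=; lra.
- by rewrite (ss _ _ ci is_ cj js nij) (piY _ (YS _ ci) is_) (piY _ (YS _ cj) js) ci cj /=; lra.
- by rewrite (sz _ _ ci is_ cj) (piY _ (YS _ ci) is_) (piT _ cj) ci; case: cj => -> _ _ /=; lra.
- by rewrite (tx _ _ ci (YR _ cj) js) (piT _ ci) (piY _ (YR _ cj) js) cj;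
    case: ci => -> _ _ /=; lra.
- by rewrite (tx _ _ ci (YS _ cj) js) (piT _ ci) (piY _ (YS _ cj) js) cj;
    case: ci => -> _ _ /=; lra.
- by rewrite (tz _ _ ci cj nij) (piT _ ci) (piT _ cj);
    case: ci => -> _ _; case: cj => -> _ _ /=; lra.
Qed.

End Swaps.

(** * Nondegeneracy and the facet *)

(** A path starting with 0, [k], [s1], [s2] enters [k] in [T] from outside [S] and leaves [s1] in
    [S] to outside [T]. These two losses exceed the single unit of slack of a tight path. *)
Lemma non_tight_path : exists2 q, is_p_path p q & ~~ tight q.
Proof.
have [k [ck k0 kn] _] := @fresh_T [::] m1.
have [s1 cs1 _] := @fresh_S [::] (leq0n _).
have [s2 cs2 /= /andP[s21 _]] := @fresh_S [:: s1] m1.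
have kT : k \in T by rewrite clsT ck.
have s1S : s1 \in S by rewrite clsS cs1.
have s2S : s2 \in S by rewrite clsS cs2.
have s2T := S_notin_T part T0 Tn p4 pn s2S.
have [|e _] := @fresh_elt _ [set: node n] [:: ord0; ord_max; k; s1; s2].
  by rewrite cardsT card_ord /=; clear -p4 pn; lia.
rewrite !inE !negb_or => /and5P[e0 en ek es1 es2].
have c0 := cls0; have cn := clsn.
have p3 : (3 <= p.-1)%N by clear -p4; lia.
have [||q [_ hq _]] := @extend_path n p [:: k; s1; s2] e p4 pn => //.
  have zn := ord0_neq_max T0 Tn p4 pn.
  rewrite /= !inE !negb_or; repeat (apply/andP; split); first [done | assumption |
    by rewrite eq_sym | by apply: cls_neq; rewrite ?c0 ?cn ?ck ?cs1 ?cs2].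
set w := ord0 :: _ in hq; exists w => //.
apply/negP => tq; case: (tight_counts part T0 Tn tq) => h1 h2 [h3 h4] h5 _.
have a1 : (ord0, k) \in arcs w by rewrite /w /arcs /= inE eqxx.
have a2 : (s1, s2) \in arcs w by rewrite /w /arcs /= !inE eqxx !orbT.
have l1 := tight_arc_T a1 (T_notin_S part T0 Tn p4 pn T0) kT.
have l2 := tight_arc_S part T0 Tn tq a2 s1S s2T.
by clear -h1 h2 h5 l1 l2 pE; lia.
Qed.

(* Without tight paths the swap relations would hold for every [c]. *)
Lemma exists_tight : ~ (forall q, ~~ tight q).
Proof.
move=> no.
have [s1 cs1 _] := @fresh_S [::] (leq0n _).
have [s2 cs2 /= /andP[s21 _]] := @fresh_S [:: s1] m1.
have [t It _] := @fresh_T [::] m1.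
pose c (x y : node n) : R := ((x == s1) && (y == s2))%:R.
have c_tight q : tight q -> wt c q = 0 by move=> tq; have := no q; rewrite tq.
have ns : s1 != s2 by rewrite eq_sym.
have := swap_SSTn c_tight cs1 cs2 It ns.
have [ct _ _] := It.
rewrite /c !eqxx (negbTE s21) [t == s2]eq_sym [t == s1]eq_sym.
rewrite (negbTE (@cls_neq s2 t _)) ?(negbTE (@cls_neq s1 t _)) ?cs1 ?cs2 ?ct //=.
by move/eqP; rewrite !addr0 oner_eq0.
Qed.

Hypothesis hcase : (1 < m)%N \/ (#|T| = 3 /\ 1 < #|Rs|)%N.

Lemma facet_of_conditions :
  facet_defining (@path_polytope R n p) (gen_maxcut_lhs Rs S T) b%:R.
Proof.
have p0 : (0 < p)%N by clear -p4; lia.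
have [q0 hq0 nt0] := non_tight_path.
apply: (facet_suff (g := g) _ _ p0 (A := q0)) => //.
- exact: gen_maxcut_lhsE.
- by move=> q; apply: (maxcut_bound R part T0 Tn).
- move=> f f0.
  have ft q : tight q -> wt f q = 0.
    move=> tq; have hq := tight_p_path tq.
    by apply: f0 => //; apply/eqP; rewrite (tightE R part T0 Tn).
  have [s0 cs0 _] := @fresh_S [::] (leq0n _).
  (* Adding the potential difference of [psi] cancels [f] on the arcs out of [s0] and changes the
     weight of every path by the same constant. The value 0 at node 0 is free, since no arc enters
     it. *)
  pose psi j := if (j == ord0) || (j == s0) then 0 else f s0 j.
  pose c i j := 1 * f i j + 1 * (psi i - psi j).
  have cE q : is_p_path p q -> wt c q = wt f q - psi ord_max.
    move=> /p_path_elim[l [-> _ _ ll _]].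
    rewrite /c wt_lin wt_telescope ll /psi eqxx /=; ring.
  have c_tight q : tight q -> wt c q = - psi ord_max.
    by move=> tq; rewrite cE ?ft ?add0r // (tight_p_path tq).
  have hc : (1 < m)%N \/ (forall t u, inner_T t -> inner_T u -> t = u) /\ (1 < #|Rs|)%N.
    case: hcase => [|[T3 r2]]; [by left | right; split=> // t u [ct t0 tn] [cu u0 un]].
    have /eqP/cards1P[k kE] : #|T :\ ord0 :\ ord_max| = 1%N.
      have := cardT0 T0; have := card_T_inner T0 Tn p4 pn; rewrite T3.
      by move=> -> [<-].
    have : t \in [set k] by rewrite -kE !inE clsT ct t0 tn.
    have : u \in [set k] by rewrite -kE !inE clsT cu u0 un.
    by rewrite !inE => /eqP -> /eqP ->.
  have [|pi [lam [mu H]]] := normal_form c_tight cs0 hc.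
    by move=> j j0 js; rewrite /c /psi (negbTE j0) (negbTE js) eqxx orbT /=; ring.
  pose K := pi ord0 - pi ord_max + p%:R * lam + psi ord_max.
  have fE q : is_p_path p q -> wt f q = K + mu * wt g q.
    move=> hq; have := cE _ hq.
    pose h i j := 1 * (pi i - pi j) + 1 * (1 * lam + mu * g i j).
    rewrite (eq_wt (h := h)); first last.
    - by case/and5P: hq.
    - by move=> i j /H ->; rewrite /h; ring.
    rewrite /h wt_lin (wt_lin (fun _ _ => lam)) wt_const.
    case/p_path_elim: hq => l [-> sl _ ll _]; rewrite wt_telescope ll /= sl /K.
    by move=> e; rewrite -[wt f _](subrK (psi ord_max)) -e; ring.
  (* Evaluating [fE] on one tight path, where [f] has weight 0, eliminates the constant [K]. *)
  have Kb : K + mu * b%:R = 0.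
    apply/eqP; apply: contraT => nz; case: exists_tight => q; apply: contraNN nz => tq.
    rewrite -(ft q tq) fE ?(tight_p_path tq) //.
    have := tq; rewrite -(tightE R part T0 Tn) ?(tight_p_path tq) // => /eqP ->.
    exact: eqxx.
  exists mu => q hq; rewrite fE //; move: Kb => /eqP; rewrite addr_eq0 => /eqP ->; ring.
- by rewrite (tightE R part T0 Tn).
Qed.

End Sufficiency.

Theorem theorem16 (R : realType) (n p : nat) (Rs S T : {set node n}) :
  (4 <= p)%N -> (p <= n - 1)%N ->
  [disjoint Rs & S] -> [disjoint Rs & T] -> [disjoint S & T] ->
  Rs :|: S :|: T = [set: node n] ->
  ord0 \in T -> ord_max \in T ->
  valid_ineq (@path_polytope R n p) (gen_maxcut_lhs Rs S T)
    ((p + #|Rs|)./2)%:R /\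
  (facet_defining (@path_polytope R n p) (gen_maxcut_lhs Rs S T)
     ((p + #|Rs|)./2)%:R <->
   [/\ odd (p + #|Rs|),
       (p < 2 * #|S| + #|Rs|)%N,
       (p < 2 * #|T :\ ord0| + #|Rs|)%N
     & ((p == #|Rs| + 3)%N && (2 <= #|Rs|)%N && (#|T| == 3)%N)
       || (#|Rs| + 5 <= p)%N]).
Proof.
move=> p4 pn dRS dRT dST cov T0 Tn.
have part x : ((x \in Rs) + (x \in S) + (x \in T) = 1)%N.
  have [xR|xR] := boolP (x \in Rs); first by rewrite (disjointFr dRS xR) (disjointFr dRT xR).
  have [xS|xS] := boolP (x \in S); first by rewrite (disjointFr dST xS).
  by have := in_setT x; rewrite -cov !inE (negbTE xR) (negbTE xS) /= => ->.
split.
  apply: (valid_of_paths (g := maxcut_weight R Rs S T)); first exact: gen_maxcut_lhsE.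
  by move=> s; apply: maxcut_bound.
split; first exact: facet_conditions.
move=> [od hS hT hc].
have pR : (#|Rs| + 3 <= p)%N.
  case/orP: hc => [/andP[/andP[/eqP -> _] _]|] //.
  by apply: leq_trans; rewrite leq_add2l.
pose m := (p - #|Rs|)./2.
have pE : p = (2 * m + 1 + #|Rs|)%N by rewrite /m; clear -od pR; lia.
apply: (@facet_of_conditions R n p m) => //.
- by clear -pE pR; lia.
- by clear -pE hS; lia.
- by clear -pE hT; lia.
case/orP: hc => [/andP[/andP[_ r2] /eqP T3]|p5]; first by right.
by left; clear -pE p5; lia.
Qed.
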